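(* Let $\mathcal{O}$ be the ring of an algebroid curve with $r$ minimal primes and semigroup of values $S$. For any fractional ideal $\mathcal{I}$ of $\mathcal{O}$ with value set $E$, with $E^*$ the value set of the dual $\mathcal{I}^*$, and for any $\alpha\in\mathbb{Z}^r$, we have $$p(E,\alpha)+q(E^*,\mathfrak{f}(S)-\alpha)\geq r+1.$$ Moreover, $\mathcal{O}$ is a Gorenstein ring if and only if equality holds in this inequality for every fractional ideal $\mathcal{I}$ of $\mathcal{O}$ and every $\alpha\in\mathbb{Z}^r$.
   Context: $\mathbb{N}$ denotes the non-negative integers. The ring of an algebroid curve is a local, reduced, complete $k$-algebra $\mathcal{O}$ of pure dimension one, finitely generated as a complete $k$-algebra (i.e. a quotient of some $k[[X_1,\dots,X_n]]$), where $k$ is an algebraically closed coefficient field of $\mathcal{O}$. Let $\wp_1,\dots,\wp_r$ be its minimal primes, $I=\{1,\dots,r\}$, $\mathcal{O}_i=\mathcal{O}/\wp_i$, and $\mathcal{K}_i$ the fraction field of $\mathcal{O}_i$. The integral closure of $\mathcal{O}_i$ in $\mathcal{K}_i$ is isomorphic to $k[[t_i]]$, so $\mathcal{K}_i\simeq k((t_i))$ with its normalized valuation $v_i$ ($v_i(0)=\infty$). Let $\mathcal{K}\simeq\mathcal{K}_1\times\cdots\times\mathcal{K}_r$ be the total ring of fractions of $\mathcal{O}$, $\pi_i:\mathcal{K}\to\mathcal{K}_i$ the projections, $Z(\mathcal{K})$ the set of elements of $\mathcal{K}$ with some zero component, $\widetilde{\mathcal{O}}$ the integral closure of $\mathcal{O}$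 in $\mathcal{K}$, and $v:\mathcal{K}\setminus Z(\mathcal{K})\to\mathbb{Z}^r$, $v(h)=(v_1(\pi_1(h)),\dots,v_r(\pi_r(h)))$. $\mathcal{O}$ is Gorenstein if $\dim_k\mathcal{O}/\mathcal{C}=\dim_k\widetilde{\mathcal{O}}/\mathcal{O}$, where $\mathcal{C}=\{h\in\mathcal{K}: h\widetilde{\mathcal{O}}\subset\mathcal{O}\}$. A fractional ideal of $\mathcal{O}$ is an $\mathcal{O}$-submodule $\mathcal{I}$ of $\mathcal{K}$ containing a regular element of $\mathcal{O}$ and such that $d\,\mathcal{I}\subset\mathcal{O}$ for some regular $d\in\mathcal{O}$. Its value set is $E=v(\mathcal{I}\setminus Z(\mathcal{K}))$; its dual is the fractional ideal $\mathcal{I}^*=\{x\in\mathcal{K}: x\mathcal{I}\subset\mathcal{O}\}$. For $\alpha\in\mathbb{Z}^r$, $\mathcal{I}(\alpha)=\{h\in\mathcal{I}: v_i(\pi_i(h))\ge\alpha_i\ \forall i\}$. $S=v(\mathcal{O}\setminus Z(\mathcal{K}))$; with the componentwise order on $\mathbb{Z}^r$, the conductor $c(S)$ is the unique least $\gamma\in S$ with $\gamma+\mathbb{N}^r\subset S$, and $\mathfrak{f}(S)=c(S)-(1,\dots,1)$. Let $e_i$ be the $i$-th standard basis vector of $\mathbb{Z}^r$, $e_J=\sum_{i\in J}e_i$ for $\emptyset\ne J\subset I$, $e_\emptyset=0$, $J^c=I\setminus J$. Put $\ell_E(\alpha,e_i)=\ell\big(\mathcal{I}(\alpha)/\mathcal{I}(\alpha+e_i)\big)$,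 where $\ell$ is length as $\mathcal{O}$-module (this is $0$ or $1$ and depends only on $E$). Define $$p(E,\alpha)=\max\{n\in\{0,\dots,r\}:\ \ell_E(\alpha+e_{J^c},e_i)=0\ \ \forall J\subset I\text{ with }\#J\le n,\ \forall i\in J\},$$ $$q(E,\alpha)=\min\{n\in\{1,\dots,r+1\}:\ \ell_E(\alpha+e_{J^c},e_i)=1\ \ \forall J\subset I\text{ with }\#J\ge n,\ \forall i\in J\}$$ (the condition for $n=0$, resp. $n=r+1$, being vacuous), and likewise for $E^*$ using $\mathcal{I}^*$. *)

(* Defs.v *)
From HB Require Import structures.
From mathcomp Require Import all_boot all_order all_algebra.
From mathcomp Require Import mpoly.
From mathcomp Require Import boolp classical_sets functions constructive_ereal.

Set Implicit Arguments.
Unset Strict Implicit.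
Unset Printing Implicit Defensive.

Import Order.TTheory GRing.Theory Num.Theory.

Local Open Scope ring_scope.
Local Open Scope classical_set_scope.

(* k[[X_1, ..., X_n]]: arbitrary coefficient functions on the monomials, with
   the convolution product. *)
Definition mpseries (n : nat) (R : Type) : Type := 'X_{1..n} -> R.

Section MPSeries.
Variables (n : nat) (R : comNzRingType).
Implicit Types (f g h : mpseries n R) (m : 'X_{1..n}).

HB.instance Definition _ :=
  GRing.Zmodule.copy (mpseries n R) ('X_{1..n} -> R).

Definition mps_one : mpseries n R := fun m => (m == 0%MM)%:R.

Definition mps_mul f g : mpseries n R := fun m =>
  \sum_(a : 'X_{1..n < (mdeg m).+1, (mdeg m).+1} | m == (a.1 + a.2)%MM)
     f a.1 * g a.2.

Definition mps_scale (c : R) f : mpseries n R := fun m => c * f m.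

Definition mps_trunc (d : nat) f : {mpoly R[n]} :=
  \sum_(m : 'X_{1..n < d}) f m *: 'X_[m].

Lemma mps_truncE d f m : (mdeg m < d)%N -> (mps_trunc d f)@_m = f m.
Proof. exact: mcoeff_mpoly. Qed.

Lemma mps_mulE (p q : {mpoly R[n]}) f g m :
  (forall a, (mdeg a <= mdeg m)%N -> f a = p@_a) ->
  (forall a, (mdeg a <= mdeg m)%N -> g a = q@_a) ->
  mps_mul f g m = (p * q)@_m.
Proof.
move=> fp gq; rewrite mcoeffM; apply: eq_bigr => -[a b] _ /=.
by rewrite fp ?gq // -ltnS bmdeg.
Qed.

Lemma mps_mul_trunc d f g m : (mdeg m < d)%N ->
  mps_mul f g m = (mps_trunc d f * mps_trunc d g)@_m.
Proof.
by move=> md; apply: mps_mulE => a am; rewrite mps_truncE //;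
  apply: leq_ltn_trans md.
Qed.

Lemma mps_mulC : commutative mps_mul.
Proof.
move=> f g; apply/funext => m.
by rewrite !(@mps_mul_trunc (mdeg m).+1) // mulrC.
Qed.

Lemma mps_mulA : associative mps_mul.
Proof.
move=> f g h; apply/funext => m; set d := (mdeg m).+1.
rewrite (@mps_mulE (mps_trunc d f) (mps_trunc d g * mps_trunc d h)).
- rewrite (@mps_mulE (mps_trunc d f * mps_trunc d g) (mps_trunc d h)) ?mulrA //.
    by move=> a am; apply: mps_mul_trunc.
  by move=> a am; rewrite mps_truncE.
- by move=> a am; rewrite mps_truncE.
- by move=> a am; apply: mps_mul_trunc.
Qed.

Lemma mps_mul1 : left_id mps_one mps_mul.
Proof.
move=> f; apply/funext => m.
rewrite (@mps_mulE 1 (mps_trunc (mdeg m).+1 f)) ?mul1r ?mps_truncE //.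
  by move=> a _; rewrite mcoeff1.
by move=> a am; rewrite mps_truncE.
Qed.

Lemma mps_mulDl : left_distributive mps_mul +%R.
Proof.
move=> f g h; apply/funext => m; rewrite /mps_mul /GRing.add /= -big_split /=.
by apply: eq_bigr => a _; rewrite -mulrDl.
Qed.

Lemma mps_oner_neq0 : mps_one != 0.
Proof.
apply/eqP => /(congr1 (fun f : mpseries n R => f 0%MM)).
by rewrite /mps_one eqxx; apply/eqP/oner_neq0.
Qed.

HB.instance Definition _ := GRing.Zmodule_isComNzRing.Build (mpseries n R)
  mps_mulA mps_mulC mps_mul1 mps_mulDl mps_oner_neq0.

Lemma mps_scaleA a b f : mps_scale a (mps_scale b f) = mps_scale (a * b) f.
Proof. by apply/funext => m; rewrite /mps_scale mulrA. Qed.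

Lemma mps_scale1 : left_id 1 mps_scale.
Proof. by move=> f; apply/funext => m; rewrite /mps_scale mul1r. Qed.

Lemma mps_scaleDr : right_distributive mps_scale +%R.
Proof. by move=> a f g; apply/funext => m; rewrite /mps_scale [LHS]mulrDr. Qed.

Lemma mps_scaleDl f : {morph mps_scale^~ f : a b / a + b}.
Proof. by move=> a b; apply/funext => m; rewrite /mps_scale mulrDl. Qed.

HB.instance Definition _ := GRing.Zmodule_isLmodule.Build R (mpseries n R)
  mps_scaleA mps_scale1 mps_scaleDr mps_scaleDl.

Lemma mps_scaleAl (a : R) f g : a *: (f * g) = (a *: f) * g.
Proof.
apply/funext => m; rewrite /GRing.scale /GRing.mul /= /mps_scale /mps_mul.
by rewrite mulr_sumr; apply: eq_bigr => b _; rewrite mulrA.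
Qed.

HB.instance Definition _ := GRing.Lmodule_isLalgebra.Build R (mpseries n R)
  mps_scaleAl.
HB.instance Definition _ := GRing.Lalgebra_isComAlgebra.Build R (mpseries n R).

End MPSeries.

Section Primes.
Variable R : comNzRingType.
Implicit Types P Q : {pred R}.

(* idealr_closed includes properness.  Ideals are boolean predicates, which is
   no restriction since every subset is one by classical choice. *)
Definition prime_ideal P := idealr_closed P /\ prime_idealr_closed P.

Definition minimal_prime P :=
  prime_ideal P /\
  forall Q, prime_ideal Q -> {subset Q <= P} -> {subset P <= Q}.

Definition strict_sub P Q := {subset P <= Q} /\ ~ {subset Q <= P}.

(* Every R/P with P a minimal prime has Krull dimension one. *)
Definition pure_dim1 :=
  forall P, minimal_prime P ->
    (exists2 Q, prime_ideal Q & strict_sub P Q) /\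
    (forall Q Q', prime_ideal Q -> prime_ideal Q' ->
       strict_sub P Q -> ~ strict_sub Q Q').

Definition reduced := forall (a : R) (n : nat), a ^+ n = 0 -> a = 0.

End Primes.

Section AlgebroidRing.
Variables (k : closedFieldType) (O : comUnitAlgType k).

Definition nonunit (a : O) := a \isn't a GRing.unit.

(* The s-th power of the ideal generated by the non-units. *)
Definition max_power (s : nat) : set O :=
  [set x | exists (N : nat) (a : 'I_N -> O) (u : 'I_N -> 'I_s -> O),
     (forall j l, nonunit (u j l)) /\
     x = \sum_(j < N) a j * \prod_(l < s) u j l].

Record algebroid_ring : Prop := AlgebroidRing {
  alg_quotient : exists (n : nat) (f : {lrmorphism mpseries n k -> O}),
    forall a, exists F, f F = a;
  alg_local : forall a b : O, nonunit a -> nonunit b -> nonunit (a + b);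
  alg_coef_field : forall a : O, exists c : k, nonunit (a - c%:A);
  alg_separated : forall a : O, (forall s, max_power s a) -> a = 0;
  alg_complete : forall a : nat -> O,
    (forall s, max_power s (a s.+1 - a s)) ->
    exists b, forall s, max_power s (b - a s);
  alg_reduced : reduced O;
  alg_pure_dim1 : pure_dim1 O
}.

End AlgebroidRing.

(* w is the discrete valuation of F with value group Z and valuation ring A.
   For A the integral closure k[[t]] of a branch, w is the order in t. *)
Record normalized_valuation (F : fieldType) (A : set F) (w : F -> \bar int)
    : Prop := NormalizedValuation {
  nval_eqy : forall x, w x = +oo%E <-> x = 0;
  nval_neqNy : forall x, w x <> -oo%E;
  nval_mul : forall x y, w (x * y) = (w x + w y)%E;
  nval_add : forall x y, (Order.min (w x) (w y) <= w (x + y)%R)%E;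
  nval_onto : exists t, w t = 1%:E;
  nval_ring : forall x, (0%:E <= w x)%E <-> A x
}.

Section Curve.
Variables (k : closedFieldType) (O K : comUnitAlgType k).
Variables (iota : {lrmorphism O -> K}) (r : nat).
Variables (P : 'I_r -> {pred O}) (L : 'I_r -> fieldType).
Variables (pi : forall i, {rmorphism K -> L i}).
Variables (v : forall i, L i -> \bar int).

(* (K, iota) is the total ring of fractions of O; GRing.lreg a says that a is
   not a zero divisor. *)
Definition total_fractions :=
  [/\ injective iota,
      forall a : O, GRing.lreg a -> iota a \is a GRing.unit
    & forall x : K, exists a b : O, GRing.lreg b /\ x = iota a / iota b].

(* L i is the fraction field of O/(P i), along pi i \o iota. *)
Definition branch_field (i : 'I_r) :=
  (forall a : O, pi i (iota a) = 0 <-> a \in P i) /\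
  (forall y : L i, exists a b : O,
     b \notin P i /\ y = pi i (iota a) / pi i (iota b)).

Record algebroid_curve : Prop := AlgebroidCurve {
  curve_ring : algebroid_ring O;
  curve_primes_minimal : forall i, minimal_prime (P i);
  curve_primes_all : forall Q : {pred O}, minimal_prime Q ->
    exists i, Q =i P i;
  curve_primes_inj : forall i j, P i =i P j -> i = j;
  curve_fractions : total_fractions;
  curve_branch : forall i, branch_field i;
  curve_product : forall y : (forall i, L i),
    exists! x : K, forall i, pi i x = y i;
  curve_valuation : forall i,
    normalized_valuation [set y | integralOver (pi i \o iota) y] (@v i)
}.

Notation Zr := {ffun 'I_r -> int}.
Implicit Types (I A B M : set K) (alpha beta gamma : Zr) (J : {set 'I_r}).

Definition zero_comp : set K := [set h | exists i, pi i h = 0].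

(* Only meaningful off zero_comp, where no v (pi i h) is infinite. *)
Definition vmap (h : K) : Zr := [ffun i => fine (v (pi i h))].

Definition value_set I : set Zr := vmap @` (I `\` zero_comp).

Definition Zle alpha beta := forall i, alpha i <= beta i.

(* gamma is the least element of S with gamma + N^r contained in S. *)
Definition is_conductor (S : set Zr) gamma :=
  let absorbing g := S g /\ forall beta, Zle g beta -> S beta in
  absorbing gamma /\ forall g, absorbing g -> Zle gamma g.

Definition frob (c : Zr) : Zr := c - [ffun=> 1].

Definition is_submodule M :=
  [/\ M 0, forall x y, M x -> M y -> M (x + y)
    & forall (a : O) x, M x -> M (iota a * x)].

Definition fractional_ideal I :=
  [/\ is_submodule I,
      exists2 a : O, GRing.lreg a & I (iota a)
    & exists2 d : O, GRing.lreg d & forall x, I x -> range iota (iota d * x)].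

Definition dual I : set K :=
  [set x | forall y, I y -> range iota (x * y)].

Definition level I alpha : set K :=
  [set h | I h /\ forall i, ((alpha i)%:E <= v (pi i h))%E].

(* The O-module A/B has length n: there is a composition series from B to A. *)
Definition quot_length A B (n : nat) :=
  exists M : nat -> set K,
    [/\ M 0%N = B, M n = A, forall j, (j <= n)%N -> is_submodule (M j)
      & forall j, (j < n)%N -> M j `<` M j.+1 /\
          forall N, is_submodule N -> M j `<=` N -> N `<=` M j.+1 ->
            N = M j \/ N = M j.+1].

Definition e_ J : Zr := [ffun i => (i \in J)%:R].

Definition ell I alpha (i : 'I_r) (n : nat) :=
  quot_length (level I alpha) (level I (alpha + e_ [set i]%SET)) n.

Definition p_cond I alpha (n : nat) :=
  forall J, (#|J| <= n)%N ->
    forall i, i \in J -> ell I (alpha + e_ (~: J)) i 0.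

Definition q_cond I alpha (n : nat) :=
  forall J, (n <= #|J|)%N ->
    forall i, i \in J -> ell I (alpha + e_ (~: J)) i 1.

Definition p_ I alpha : nat :=
  \max_(0 <= n < r.+1 | `[< p_cond I alpha n >]) n.

(* The default value r.+1 is itself a candidate, its condition being vacuous. *)
Definition q_ I alpha : nat :=
  \big[minn/r.+1]_(1 <= n < r.+2 | `[< q_cond I alpha n >]) n.

Definition normalization : set K := [set x | integralOver iota x].

Definition conductor_ideal : set K :=
  [set h | forall y, normalization y -> range iota (h * y)].

(* dim_k A/B = n, for k-subspaces B of A: some e_1, ..., e_n in A form a basis
   of A modulo B. *)
Definition quot_dim A B (n : nat) :=
  exists2 e : 'I_n -> K, (forall j, A (e j)) &
    forall x, A x ->
      exists! c : {ffun 'I_n -> k}, B (x - \sum_(j < n) c j *: e j).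

(* Both dimensions are finite for an algebroid curve. *)
Definition gorenstein :=
  exists n, quot_dim (range iota) conductor_ideal n /\
            quot_dim normalization (range iota) n.

End Curve.

(* Main.v *)
Require Import Defs.
From HB Require Import structures.
From mathcomp Require Import all_boot all_order all_algebra.
From mathcomp Require Import boolp classical_sets functions constructive_ereal.
From mathcomp Require Import ring zify.

(** Write [K(a)] for the elements of [K] of value at least [a], and say that a
    submodule [I] is hit at [(b, i)] when it has an element of value at least [b]
    with equality at [i]. Since the residue field of every branch is [k] (lemma
    [residue]), the length [ell I b i] is 1 or 0 according to whether [I] is hit at
    [(b, i)] or not.

    Everything rests on one duality: [I] at [(b, i)] against its dual at
    [(c - b - e_i, i)]. They are never both hit ([dual_hit]), because the product
    of two witnesses would be an element of [O] of value [c_i - 1] at [i] and at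
    least [c_j] elsewhere, and by minimality of the conductor there is none
    ([no_frob]); here it is used that [K(c)] lies in [O], which follows from
    completeness ([val_ge_cond_sub]). In the definitions of [p] and [q] the duality
    exchanges [J] with [J' = J^c + i], of cardinal [r + 1 - #J], and the inequality
    is then a matter of counting ([p_q_ge]). Equality holds as soon as exactly one
    of the two is hit at each [(b, i)] ([p_q_eq]); for [I = O] this is the symmetry
    of [O]. So two things remain.

    The Gorenstein condition implies this exactness for every [I]. Dimensions are
    counted as numbers of hits along a walk of unit steps in [Z^r], through any
    prescribed [(b, i)], from very small to very large values. Along a walk of
    length [N] and its mirror image under [b |-> c - b], the hits of [K(g)] and
    [K(c - g)] add up to [N]; comparing [O] with the conductor [K(c)] and the
    normalization [K(0)] gives [N + dim O/C - dim O~/O] for [O] and itself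
    ([hits_range_quot_dim]). Thus being Gorenstein amounts to the symmetry of [O].
    When [O] is symmetric, its maximal ideal [m] has one hit fewer than [O], hence
    [m^*/O] is at most a line ([dual_max_ideal_line]). It follows that enlarging a
    module by one dimension shrinks its dual by at most one dimension
    ([dual_adjoin_line]); going from a small [K(b)] up to [I] shows that the hits
    of [I] and of its dual add up to at least [N], so exactly one of the two is hit
    at each step ([symmetric_dual]).

    Conversely, equality for the single ideal [O] already implies that [O] is
    symmetric: [p >= 1] forces [q <= r], that is, if no element of [O] has value
    [a_l] at some [l] and more than [a_j] elsewhere, then [O] is hit at
    [(c - 1 - a, i)] for every [i]. Whenever [O] is not hit at [(b, i)], lowering
    [b] off [i] leads to such an [a] ([gap_descends]). *)

Import Order.TTheory GRing.Theory Num.Theory.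
Local Open Scope ring_scope.
Local Open Scope classical_set_scope.

Set Implicit Arguments.
Unset Strict Implicit.
Unset Printing Implicit Defensive.

(** * Counting the jumps of a filtration *)

Section Filtrations.
Variables (k : fieldType) (V : lmodType k).
Implicit Types (A B : set V) (x y : V).

Definition subspace A := A 0 /\ forall (a : k) x y, A x -> A y -> A (a *: x + y).

Definition adjoin B x : set V := [set y | exists a : k, B (y - a *: x)].

Lemma subspaceZ A a x : subspace A -> A x -> A (a *: x).
Proof. by move=> [A0 AZD] Ax; rewrite -[_ *: _]addr0; apply: AZD. Qed.

Lemma subspaceD A x y : subspace A -> A x -> A y -> A (x + y).
Proof. by move=> [A0 AZD] Ax Ay; rewrite -[x]scale1r; apply: AZD. Qed.

Lemma subspaceB A x y : subspace A -> A x -> A y -> A (x - y).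
Proof. by move=> [A0 AZD] Ax Ay; rewrite -scaleN1r addrC; apply: AZD. Qed.

Lemma subspaceZl A a x : subspace A -> a != 0 -> A (a *: x) -> A x.
Proof. by move=> sA a0 /(subspaceZ a^-1 sA); rewrite scalerA mulVf ?scale1r. Qed.

Lemma subspace_adjoin B x : subspace B -> subspace (adjoin B x).
Proof.
move=> sB; split; first by exists 0; rewrite scale0r subr0; case: sB.
move=> a y z [b By] [d Bz]; exists (a * b + d).
rewrite scalerDl -scalerA opprD addrACA -scalerBr.
by case: sB => _; apply.
Qed.

Lemma sub_adjoin B x : B `<=` adjoin B x.
Proof. by move=> y By; exists 0; rewrite scale0r subr0. Qed.

Lemma mem_adjoin B x : subspace B -> adjoin B x x.
Proof. by case=> B0 _; exists 1; rewrite scale1r subrr. Qed.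

Lemma adjoin_sub A B x : subspace A -> B `<=` A -> A x -> adjoin B x `<=` A.
Proof.
move=> sA BA Ax y [a /BA Ay].
by rewrite -[y](subrK (a *: x)); apply: subspaceD => //; apply: subspaceZ.
Qed.

Variables (F : nat -> set V) (N : nat).

(** Dimensions of subquotients of [F 0 / F N] are measured by the number of steps
    at which the filtration induced on [A] jumps. *)
Record line_filtration : Prop := LineFiltration {
  filt_subspace : forall s, subspace (F s);
  filt_step : forall s, (s < N)%N -> F s.+1 `<=` F s;
  filt_line : forall s x y, (s < N)%N -> F s x -> ~ F s.+1 x -> F s y ->
    exists a : k, F s.+1 (y - a *: x)
}.

Definition jump A s := `[< exists h, [/\ A h, F s h & ~ F s.+1 h] >].

Definition jumps A := (\sum_(s < N) jump A s)%N.

Lemma jump_mono A B s : A `<=` B -> (jump A s <= jump B s)%N.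
Proof.
move=> AB; rewrite /jump; case: asboolP => // -[h [Ah Fh nFh]].
by rewrite asboolT //; exists h; split=> //; apply: AB.
Qed.

Lemma jumps_mono A B : A `<=` B -> (jumps A <= jumps B)%N.
Proof. by move=> AB; apply: leq_sum => s _; apply: jump_mono. Qed.

Hypothesis filtF : line_filtration.

Lemma filt_le s t x : (s <= t <= N)%N -> F t x -> F s x.
Proof.
elim: t => [|t IH] /andP[st tN] Fx; first by move: st Fx; rewrite leqn0 => /eqP->.
move: st; rewrite leq_eqVlt => /orP[/eqP-> //|st].
by apply: IH; [rewrite -ltnS st ltnW | apply: (filt_step filtF)].
Qed.

(** The last index at which [A] still leaves [B] locates where [A] first
    exceeds [B], seen from the small end of the filtration. *)
Lemma last_outside A B : A `<=` F 0%N -> A `&` F N `<=` B -> ~ A `<=` B ->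
  exists s, [/\ (s < N)%N, exists x, [/\ A x, F s x & ~ B x] & A `&` F s.+1 `<=` B].
Proof.
move=> AF0 AFN nAB.
have ex : exists s, `[< A `&` F s `<=` B >] by exists N; apply/asboolP.
case: (ex_minnP ex) => -[|s] /asboolP ABs mins.
  by case: nAB => x Ax; apply: ABs; split=> //; apply: AF0.
have sN : (s < N)%N by apply: mins; apply/asboolP.
exists s; split=> //.
have : ~ A `&` F s `<=` B.
  by move=> H; have := mins s (asboolT H); rewrite ltnn.
by move/existsNP => [x /not_implyP [[Ax Fx] nBx]]; exists x.
Qed.

(** At the last step where [A] exceeds [B] only [A] can jump. *)
Lemma jumps_lt A B : subspace A -> subspace B -> B `<=` A -> A `<=` F 0%N ->
  A `&` F N `<=` B -> ~ A `<=` B -> (jumps B < jumps A)%N.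
Proof.
move=> sA sB BA AF0 AFN nAB.
have [s [sN [x [Ax Fx nBx]] AFB]] := last_outside AF0 AFN nAB.
have nFx : ~ F s.+1 x by move=> Fsx; apply: nBx; apply: AFB.
rewrite /jumps (bigD1 (Ordinal sN)) //= [X in (_ < X)%N](bigD1 (Ordinal sN)) //=.
rewrite -addSn; apply: leq_add; last first.
  by apply: leq_sum => t _; apply: jump_mono.
rewrite [X in (_ <= nat_of_bool X)%N]asboolT; last by exists x.
suff -> : jump B s = false by [].
(* an element of B at this step would, after subtraction of a multiple, push x into B *)
apply/asboolP => -[y [By Fy nFy]]; apply: nBx.
have [a Fxy] := filt_line filtF sN Fy nFy Fx.
rewrite -[x](subrK (a *: y)); apply: subspaceD => //; last exact: subspaceZ.
apply: AFB; split=> //; apply: subspaceB => //; apply: subspaceZ => //.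
exact: BA.
Qed.

Lemma jumps_eq_sub A B : subspace A -> subspace B -> B `<=` A -> A `<=` F 0%N ->
  A `&` F N `<=` B -> (jumps A <= jumps B)%N -> A `<=` B.
Proof.
move=> sA sB BA AF0 AFN le; apply: contrapT => nAB.
by have := jumps_lt sA sB BA AF0 AFN nAB; rewrite ltnNge le.
Qed.

(** Two new jumps of [B + k x] would come from two vectors congruent modulo
    [B] up to a scalar, so the earlier jump would already be one of [B]. *)
Lemma jumps_adjoin_le B x : subspace B -> (jumps (adjoin B x) <= (jumps B).+1)%N.
Proof.
move=> sB.
have new s : jump (adjoin B x) s -> ~~ jump B s ->
    exists y a, [/\ a != 0, B (y - a *: x), F s y & ~ F s.+1 y].
  move=> /asboolP [y [[a By] Fy nFy]] /asboolP nB.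
  exists y, a; split=> //; apply/eqP => a0.
  by apply: nB; exists y; split=> //; move: By; rewrite a0 scale0r subr0.
have uniq_new s t : (s < t < N)%N -> jump (adjoin B x) s -> ~~ jump B s ->
    jump (adjoin B x) t -> ~~ jump B t -> False.
  move=> /andP[st tN] As Bs At Bt.
  have [y [a [a0 By Fy nFy]]] := new s As Bs.
  have [z [b [b0 Bz Fz nFz]]] := new t At Bt.
  have Fz1 : F s.+1 z by apply: filt_le Fz; rewrite st ltnW.
  move/asboolP: Bs; apply; exists (b *: y - a *: z); split.
  - have -> : b *: y - a *: z = b *: (y - a *: x) - a *: (z - b *: x).
      by rewrite !scalerBr !scalerA [b * a]mulrC opprB addrA subrK.
    by apply: subspaceB => //; apply: subspaceZ.
  - apply: subspaceB; [exact: (filt_subspace filtF)| |]; apply: subspaceZ => //;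
      try exact: (filt_subspace filtF).
    by apply: (filt_step filtF) => //; apply: ltn_trans tN.
  - move=> Fyz; apply: nFy; apply: (subspaceZl (filt_subspace filtF _) b0).
    rewrite -[b *: y](subrK (a *: z)); apply: subspaceD => //;
      try exact: (filt_subspace filtF).
    by apply: subspaceZ => //; exact: (filt_subspace filtF).
case: (pselect (exists s : 'I_N, jump (adjoin B x) s && ~~ jump B s)) => [[s /andP[As Bs]]|none].
  rewrite /jumps (bigD1 s) //= [X in (_ <= X.+1)%N](bigD1 s) //= -addSn.
  apply: leq_add; first by rewrite As.
  apply: leq_sum => t ts.
  case At: (jump (adjoin B x) t) => //; case Bt: (jump B t) => //.
  case: (ltngtP s t) => [st|st|st].
  - by case: (uniq_new s t); rewrite ?st ?ltn_ord ?At ?Bt.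
  - by case: (uniq_new t s); rewrite ?st ?ltn_ord ?At ?Bt.
  - by case/eqP: ts; apply: val_inj.
apply: leqW; apply: leq_sum => t _.
case At: (jump (adjoin B x) t) => //; case Bt: (jump B t) => //.
by case: none; exists t; rewrite At Bt.
Qed.

Lemma jumps_adjoin B x : subspace B -> B `<=` F 0%N -> F N `<=` B -> F 0%N x ->
  ~ B x -> jumps (adjoin B x) = (jumps B).+1.
Proof.
move=> sB BF0 FNB Fx nBx; apply/eqP; rewrite eqn_leq jumps_adjoin_le //=.
apply: jumps_lt => //; first exact: subspace_adjoin.
- exact: sub_adjoin.
- by apply: adjoin_sub => //; apply: (filt_subspace filtF).
- by move=> y [_ /FNB].
- by move=> /(_ x (mem_adjoin x sB)).
Qed.

End Filtrations.

(** * Dimensions of quotients *)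

Section QuotDim.
Variables (k : closedFieldType) (K : comUnitAlgType k).
Implicit Types (A B : set K) (x : K).

Lemma quot_dim0 A : subspace A -> quot_dim A A 0.
Proof.
move=> sA; exists (fun=> 0) => [[]//|x Ax]; exists 0; split.
  by rewrite big_ord0 subr0.
by move=> f _; apply/ffunP => -[].
Qed.

Lemma quot_dim0_sub A B : quot_dim A B 0 -> A `<=` B.
Proof. by case=> e _ H x /H [c []]; rewrite big_ord0 subr0. Qed.

Lemma quot_dim_adjoin A B x n : subspace A -> subspace B -> A x -> ~ B x ->
  quot_dim A (adjoin B x) n -> quot_dim A B n.+1.
Proof.
move=> sA sB Ax nBx [e Ae eP].
pose e' (j : 'I_n.+1) := if unlift ord0 j is Some j' then e j' else x.
have e'0 : e' ord0 = x by rewrite /e' unlift_none.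
have e'S j : e' (lift ord0 j) = e j by rewrite /e' liftK.
have sumE (c : {ffun 'I_n.+1 -> k}) : \sum_(j < n.+1) c j *: e' j =
    c ord0 *: x + \sum_(j < n) [ffun j => c (lift ord0 j)] j *: e j.
  rewrite big_ord_recl e'0; congr (_ + _).
  by apply: eq_bigr => j _; rewrite e'S ffunE.
exists e' => [j|y /eP [c [[a Ba] cU]]].
  by rewrite /e'; case: unlift => [j'|]; [apply: Ae|].
pose c' : {ffun 'I_n.+1 -> k} :=
  [ffun j => if unlift ord0 j is Some j' then c j' else a].
have c'S : [ffun j => c' (lift ord0 j)] = c.
  by apply/ffunP => j; rewrite !ffunE liftK.
exists c'; split; first by rewrite sumE c'S ffunE unlift_none opprD addrA addrAC.
move=> d; rewrite sumE => Bd.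
have dS : c = [ffun j => d (lift ord0 j)].
  by apply: cU; exists (d ord0); rewrite -addrA -opprD [X in _ - X]addrC.
have d0 : a = d ord0.
  apply/eqP; rewrite -subr_eq0; apply/eqP; apply: contrapT => /eqP ad.
  apply: nBx; apply: (subspaceZl sB ad).
  have := subspaceB sB Bd Ba; rewrite -dS scalerBl.
  move: (a *: x) (d ord0 *: x) (\sum_(j < n) _) => u w z.
  by rewrite (_ : _ - (w + z) - _ = u - w) //; ring.
apply/ffunP => j; rewrite ffunE; case: unliftP => [j' ->|-> //].
by rewrite dS ffunE.
Qed.

Lemma quot_dimS A B n : subspace A -> subspace B -> quot_dim A B n.+1 ->
  exists x, [/\ A x, ~ B x & quot_dim A (adjoin B x) n].
Proof.
move=> sA sB [e Ae eP]; exists (e ord0); split=> //.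
- move=> Be; have [c [_ cU]] := eP _ sA.1.
  have c0 : c = 0.
    apply: cU; rewrite sub0r big1 ?oppr0; first exact: sB.1.
    by move=> j _; rewrite ffunE scale0r.
  have : c = [ffun j => (j == ord0)%:R].
    apply: cU; rewrite sub0r (bigD1 ord0) //= ffunE eqxx scale1r big1 ?addr0.
      by rewrite -sub0r; apply: subspaceB => //; exact: sB.1.
    by move=> j j0; rewrite ffunE (negPf j0) scale0r.
  by rewrite c0 => /ffunP/(_ ord0)/eqP; rewrite !ffunE eqxx eq_sym oner_eq0.
- exists (fun j => e (lift ord0 j)) => // y /eP [c [Bc cU]].
  exists [ffun j => c (lift ord0 j)]; split.
    exists (c ord0); move: Bc; rewrite big_ord_recl opprD addrA addrAC.
    by under [X in B (_ - X - _) -> _]eq_bigr do rewrite -[c _](ffunE (fun j => c (lift ord0 j))).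
  move=> d [a Ba].
  have -> : c = [ffun j => if unlift ord0 j is Some j' then d j' else a].
    apply: cU; rewrite big_ord_recl ffunE unlift_none opprD addrA addrAC.
    by under eq_bigr do rewrite ffunE liftK.
  by apply/ffunP => j; rewrite !ffunE liftK.
Qed.

Variables (F : nat -> set K) (N : nat).
Hypothesis filtF : line_filtration F N.

(** Adjoining the vectors of a basis of [A/B] one at a time adds one jump each. *)
Lemma quot_dim_jumps A B n : subspace A -> subspace B -> B `<=` A ->
  A `<=` F 0%N -> F N `<=` B -> quot_dim A B n ->
  jumps F N A = (jumps F N B + n)%N.
Proof.
move=> sA + + AF0; elim: n B => [|n IH] B sB BA FNB AB.
  have AsB := quot_dim0_sub AB.
  by rewrite addn0 (_ : A = B) //; apply/seteqP.
have [x [Ax nBx ABx]] := quot_dimS sA sB AB.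
rewrite (IH (adjoin B x)) //.
- rewrite (jumps_adjoin filtF) ?addSnnS // => [y By|]; last exact: AF0.
  by apply: AF0; apply: BA.
- exact: subspace_adjoin.
- exact: adjoin_sub.
- by apply: subset_trans FNB _; apply: sub_adjoin.
Qed.

Lemma quot_dim_exists A B : subspace A -> subspace B -> B `<=` A ->
  A `<=` F 0%N -> F N `<=` B -> exists n, quot_dim A B n.
Proof.
move=> sA + + AF0.
have [m] := ubnP (jumps F N A - jumps F N B)%N.
elim: m B => // m IH B ltm sB BA FNB.
have [AB|/existsNP [x /not_implyP [Ax nBx]]] := pselect (A `<=` B).
  by exists 0%N; rewrite (_ : A = B); [exact: quot_dim0|apply/seteqP].
have BF0 : B `<=` F 0%N by apply: subset_trans AF0.
have := jumps_adjoin filtF sB BF0 FNB (AF0 _ Ax) nBx => jE.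
have le : (jumps F N (adjoin B x) <= jumps F N A)%N.
  by apply: jumps_mono; apply: adjoin_sub.
have [||n ABn] := IH (adjoin B x) _ (subspace_adjoin x sB) (adjoin_sub sA BA Ax).
- by move: ltm le; rewrite jE; lia.
- by apply: subset_trans FNB _; apply: sub_adjoin.
by exists n.+1; apply: quot_dim_adjoin ABn.
Qed.

End QuotDim.

(** * Normalized valuations *)

Section NormalizedValuation.
Variables (F : fieldType) (A : set F) (w : F -> \bar int).
Hypothesis nw : normalized_valuation A w.
Implicit Types (x y : F) (m n : int).

Lemma nval0 : w 0 = +oo%E.
Proof. by apply/(nval_eqy nw). Qed.

Lemma nval_fin x : x != 0 -> exists n, w x = n%:E.
Proof.
move=> x0; case wx: (w x) => [n||]; first by exists n.
- by case/eqP: x0; apply/(nval_eqy nw).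
- by case: (nval_neqNy nw wx).
Qed.

Lemma nval_neq0 x n : w x = n%:E -> x != 0.
Proof. by apply: contra_eq_neq => ->; rewrite nval0. Qed.

Lemma nval1 : w 1 = 0%:E.
Proof.
have [n wn] := nval_fin (oner_neq0 F).
have := nval_mul nw 1 1; rewrite mulr1 wn -EFinD => -[nn].
by congr (_%:E); lia.
Qed.

Lemma nvalV x n : w x = n%:E -> w x^-1 = (- n)%:E.
Proof.
move=> wx; have x0 := nval_neq0 wx.
have [m wm] : exists m, w x^-1 = m%:E by apply: nval_fin; rewrite invr_eq0.
have := nval_mul nw x x^-1; rewrite divff // nval1 wx wm -EFinD => -[nm].
by congr (_%:E); lia.
Qed.

Lemma nvalX x n (j : nat) : w x = n%:E -> w (x ^+ j) = (n * j%:Z)%:E.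
Proof.
move=> wx; elim: j => [|j IH]; first by rewrite expr0 nval1 mulr0.
by rewrite exprS (nval_mul nw) wx IH -EFinD; congr (_%:E); lia.
Qed.

Lemma nval_surj n : exists x, w x = n%:E.
Proof.
have [t wt] := nval_onto nw; case: n => j.
  by exists (t ^+ j); rewrite (nvalX _ wt) mul1r.
by exists (t ^+ j.+1)^-1; rewrite (nvalV (nvalX _ wt)) mul1r NegzE.
Qed.

Lemma nvalN x : w (- x) = w x.
Proof.
suff wN1 : w (- 1) = 0%:E by rewrite -mulN1r (nval_mul nw) wN1 add0e.
have [|n wn] := @nval_fin (- 1); first by rewrite oppr_eq0 oner_eq0.
have := nval_mul nw (- 1) (- 1); rewrite mulN1r opprK nval1 wn -EFinD => -[nn].
by congr (_%:E); lia.
Qed.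

Lemma nval_geD n x y : (n%:E <= w x)%E -> (n%:E <= w y)%E -> (n%:E <= w (x + y)%R)%E.
Proof.
by move=> wx wy; apply: le_trans (nval_add nw x y); rewrite le_min wx.
Qed.

Lemma nval_geB n x y : (n%:E <= w x)%E -> (n%:E <= w y)%E -> (n%:E <= w (x - y)%R)%E.
Proof. by move=> wx wy; apply: nval_geD; rewrite ?nvalN. Qed.

Lemma nval_geM m n x y : (m%:E <= w x)%E -> (n%:E <= w y)%E ->
  ((m + n)%:E <= w (x * y)%R)%E.
Proof. by move=> wx wy; rewrite (nval_mul nw) EFinD; apply: leeD. Qed.

Lemma nvalM m n x y : w x = m%:E -> w y = n%:E -> w (x * y) = (m + n)%:E.
Proof. by move=> wx wy; rewrite (nval_mul nw) wx wy EFinD. Qed.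

Lemma nval_ge_le m n x : m <= n -> (n%:E <= w x)%E -> (m%:E <= w x)%E.
Proof. by move=> mn; apply: le_trans; rewrite lee_fin. Qed.

Lemma nval_ge_succ n x : (n%:E <= w x)%E -> w x <> n%:E -> ((n + 1)%:E <= w x)%E.
Proof.
case wx: (w x) => [m||]; [|by rewrite !leey|by case: (nval_neqNy nw wx)].
by rewrite !lee_fin => nm /eqP; rewrite eqe => nem; lia.
Qed.

Lemma nval_eqD n x y : w x = n%:E -> ((n + 1)%:E <= w y)%E -> w (x + y) = n%:E.
Proof.
move=> wx wy.
have wxy : (n%:E <= w (x + y)%R)%E.
  by apply: nval_geD; [rewrite wx | apply: nval_ge_le wy; lia].
apply: contrapT => /(nval_ge_succ wxy) wxy1.
have := nval_geB wxy1 wy; rewrite addrK wx lee_fin; lia.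
Qed.

Lemma nval_prod_gt0 (I : finType) (f : I -> F) :
  (forall j, (0%:E <= w (f j))%E) -> (1%:E <= w (\prod_j f j)%R)%E ->
  exists j, (1%:E <= w (f j))%E.
Proof.
move=> f0 prod1; apply: contrapT => none.
suff wprod : w (\prod_j f j) = 0%:E by move: prod1; rewrite wprod.
apply: (big_rec (fun x => w x = 0%:E)) => [|j x _ wx]; first exact: nval1.
rewrite -[0]addr0; apply: nvalM wx; apply: contrapT => wj.
by apply: none; exists j; rewrite -[1]add0r; apply: nval_ge_succ.
Qed.

Lemma nval_sum_ge n (I : Type) (s : seq I) (f : I -> F) :
  (forall j, (n%:E <= w (f j))%E) -> (n%:E <= w (\sum_(j <- s) f j)%R)%E.
Proof.
move=> fn; elim/big_ind: _ => //; first by rewrite nval0 leey.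
by move=> x y; apply: nval_geD.
Qed.

Lemma nval_prod_ge (s : nat) (f : 'I_s -> F) :
  (forall j, (1%:E <= w (f j))%E) -> (s%:Z%:E <= w (\prod_(j < s) f j)%R)%E.
Proof.
elim: s f => [|s IH] f f1; first by rewrite big_ord0 nval1.
rewrite big_ord_recl (_ : s.+1%:Z = 1 + s%:Z); last by lia.
by apply: nval_geM => //; apply: IH.
Qed.

End NormalizedValuation.

(** * Walks in the lattice of values *)

Section Words.
Variable r : nat.
Implicit Types (a b : {ffun 'I_r -> int}) (i : 'I_r).

Definition ei i : {ffun 'I_r -> int} := e_ [set i]%SET.

Lemma eiE i j : ei i j = (j == i)%:R.
Proof. by rewrite ffunE inE. Qed.

Lemma sub_ei_eq a i : (a - ei i) i = a i - 1.
Proof. by rewrite !ffunE inE eqxx. Qed.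

Lemma sub_ei_neq a i j : j != i -> (a - ei i) j = a j.
Proof. by move=> ji; rewrite !ffunE inE (negPf ji) subr0. Qed.

Definition const_vec (n : int) : {ffun 'I_r -> int} := [ffun=> n].

Definition word_end (w : seq 'I_r) : {ffun 'I_r -> int} := \sum_(i <- w) ei i.

Definition rounds (n : nat) : seq 'I_r := flatten (nseq n (enum 'I_r)).

Lemma word_end_rounds n : word_end (rounds n) = const_vec n%:Z.
Proof.
rewrite /word_end; elim: n => [|n IH].
  by rewrite big_nil; apply/ffunP => i; rewrite !ffunE.
rewrite /rounds /= big_cat /= IH; apply/ffunP => i.
rewrite !ffunE sum_ffunE big_enum /= (bigD1 i) //= eiE eqxx.
rewrite big1 => [|j ji]; first by rewrite addr0 intS.
by rewrite eiE eq_sym (negPf ji).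
Qed.

Lemma exists_bound a : exists n : nat, forall i, a i <= n%:Z.
Proof.
exists (\sum_i `|a i|)%N => i.
rewrite (bigD1 i) //= PoszD.
by have := ler_norm (a i); lia.
Qed.

End Words.

(** * Values on a curve *)

Section Curve.
Variables (k : closedFieldType) (O K : comUnitAlgType k).
Variables (iota : {lrmorphism O -> K}) (r : nat) (P : 'I_r -> {pred O}).
Variables (L : 'I_r -> fieldType) (pi : forall i, {rmorphism K -> L i}).
Variables (v : forall i, L i -> \bar int).
Hypothesis curve : algebroid_curve iota P pi v.

Notation Zr := {ffun 'I_r -> int}.
Implicit Types (alpha beta gamma : Zr) (i j : 'I_r) (x y h : K) (a b : O).

Local Notation nv i := (curve_valuation curve i).
Local Notation vpi i h := (@v i (pi i h)).

Lemma component_ext x y : (forall i, pi i x = pi i y) -> x = y.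
Proof.
move=> xy; have [z [_ zU]] := curve_product curve (fun i => pi i y).
by rewrite -(zU x) // -(zU y).
Qed.

Lemma component_exists (f : forall i, L i) : exists x, forall i, pi i x = f i.
Proof. by have [x [xf _]] := curve_product curve f; exists x. Qed.

Lemma scale_iota (c : k) x : c *: x = iota c%:A * x.
Proof. by rewrite rmorph_alg mulr_algl. Qed.

Lemma branch_morphism i :
  exists phi : {rmorphism O -> L i}, forall a, phi a = pi i (iota a).
Proof. by exists (pi i \o iota). Qed.

Lemma val_iota_ge0 i a : (0%:E <= vpi i (iota a))%E.
Proof. by apply/(nval_ring (nv i)); apply: (integral_id (pi i \o iota)). Qed.

Lemma val_scale_ge i (c : k) n x : (n%:E <= vpi i x)%E -> (n%:E <= vpi i (c *: x))%E.
Proof.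
move=> nx; rewrite scale_iota rmorphM /= -[n]add0r.
by apply: (nval_geM (nv i)) => //; apply: val_iota_ge0.
Qed.

Lemma nonunitMl a b : nonunit a -> nonunit (b * a).
Proof. by rewrite /nonunit unitrM negb_and orbC => ->. Qed.

(** If [a] had value 0, an integral equation of its inverse would turn into
    [1 + b a = 0] on the branch, while [1 + b a] is a unit of the local ring. *)
Lemma val_nonunit i a : nonunit a -> (1%:E <= vpi i (iota a))%E.
Proof.
move=> nua; rewrite -[1]add0r; apply: (nval_ge_succ (nv i) (val_iota_ge0 i a)) => va0.
have [phi phiE] := branch_morphism i; rewrite -phiE in va0.
have phia : phi a != 0 by apply: (nval_neq0 (nv i) va0).
have : (0%:E <= v (phi a)^-1)%E by rewrite (nvalV (nv i) va0) oppr0.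
move/(nval_ring (nv i)) => -[p pmon].
rewrite -(eq_map_poly phiE) => /rootP pa.
have szp : size p = (size p).-1.+1.
  by rewrite prednK // lt0n size_poly_eq0 monic_neq0.
set n := (size p).-1 in szp.
pose b := \sum_(j < n) p`_j * a ^+ (n - j.+1).
have : phi (1 + b * a) = 0.
  have <- : (map_poly phi p).[(phi a)^-1] * phi a ^+ n = phi (1 + b * a).
    rewrite (@horner_coef_wide _ n.+1) ?mulr_suml ?big_ord_recr /=; last first.
      by rewrite -szp size_poly.
    rewrite [RHS]rmorphD addrC; congr (_ + _).
      rewrite coef_map /= -[p`__]/(lead_coef p) (monicP pmon) rmorph1 mul1r.
      by rewrite exprVn mulVf ?expf_neq0 ?rmorph1.
    rewrite rmorph_sum; apply: eq_bigr => j _.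
    rewrite coef_map /= !rmorphM rmorphXn -!mulrA; congr (_ * _).
    have -> : (phi a ^+ n = phi a ^+ j * phi a ^+ (n - j.+1) * phi a)%R.
      by rewrite -exprD -exprSr; congr (_ ^+ _); have := ltn_ord j; lia.
    by rewrite exprVn !mulrA mulVf ?mul1r ?expf_neq0.
  by rewrite pa mul0r.
have : 1 + b * a \is a GRing.unit.
  apply/negPn/negP => nu; have : nonunit (1 : O).
    rewrite -[1](addrK (b * a)); apply: (alg_local (curve_ring curve)) => //.
    by rewrite -mulNr; apply: nonunitMl.
  by rewrite /nonunit unitr1.
by move=> /(rmorph_unit phi) + phi0; rewrite phi0 unitr0.
Qed.

(** The residue field of a branch is [k]: an integral equation reduces modulo
    the maximal ideal to one over [k], which splits into linear factors. *)
Lemma residue i (y : L i) : (0%:E <= v y)%E ->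
  exists c : k, (1%:E <= v (y - pi i (iota c%:A)))%E.
Proof.
move=> y0; move/(nval_ring (nv i)): (y0) => -[p pmon].
have [phi phiE] := branch_morphism i.
rewrite -(eq_map_poly phiE) => /rootP py.
have phi0 a : (0%:E <= v (phi a))%E by rewrite phiE; apply: val_iota_ge0.
have [res resP] := choice (alg_coef_field (curve_ring curve)).
have [psi psiE] : exists psi : {rmorphism k -> L i}, forall z, psi z = phi z%:A.
  by exists (phi \o in_alg O).
pose q := \poly_(j < size p) res p`_j.
have qlead : res (lead_coef p) != 0.
  rewrite (monicP pmon); apply/eqP => r0; have := resP 1.
  by rewrite r0 scale0r subr0 /nonunit unitr1.
have sizeq : size q = size p by rewrite size_poly_eq.
have p0 : (0 < size p)%N by rewrite lt0n size_poly_eq0 monic_neq0.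
have leadq : lead_coef q = res (lead_coef p).
  by rewrite /lead_coef sizeq coef_poly prednK // leqnn.
have vq : (1%:E <= v (map_poly psi q).[y])%E.
  have -> : (map_poly psi q).[y] =
      (map_poly phi p).[y] - \sum_(j < size p) phi (p`_j - (res p`_j)%:A) * y ^+ j.
    rewrite !(@horner_coef_wide _ (size p)) ?size_poly //; last by rewrite -sizeq size_poly.
    rewrite -sumrB; apply: eq_bigr => j _.
    by rewrite !coef_map /= coef_poly ltn_ord rmorphB mulrBl psiE subKr.
  rewrite py sub0r (nvalN (nv i)); apply: (nval_sum_ge (nv i)) => j.
  rewrite -[1]addr0; apply: (nval_geM (nv i)); first by rewrite phiE; apply: val_nonunit.
  by elim: (j : nat) => [|n IH]; [rewrite expr0 (nval1 (nv i))
    | rewrite exprS -[0]addr0; apply: (nval_geM (nv i))].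
have [s qE] := closed_field_poly_normal q.
rewrite -leadq in qlead; move: (lead_coef q) qE qlead => l qE l0.
have : (1%:E <= v (\prod_(j < size s) (y - psi (s`_j)))%R)%E.
  have -> : \prod_(j < size s) (y - psi s`_j) = psi l^-1 * (map_poly psi q).[y].
    rewrite qE map_polyZ /= hornerZ mulrA -rmorphM mulVf // rmorph1 mul1r.
    rewrite rmorph_prod horner_prod (big_nth 0) big_mkord.
    by apply: eq_bigr => j _; rewrite /= map_polyXsubC hornerXsubC.
  by rewrite -[1]add0r; apply: (nval_geM (nv i)) => //; rewrite psiE.
move=> /(nval_prod_gt0 (nv i)) [j|j ?]; last by exists s`_j; rewrite -phiE -psiE.
by apply: (nval_geB (nv i)) => //; rewrite psiE.
Qed.

Lemma line_step i n x y : vpi i x = n%:E -> (n%:E <= vpi i y)%E ->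
  exists c : k, ((n + 1)%:E <= vpi i (y - c *: x)%R)%E.
Proof.
move=> vx vy; have x0 := nval_neq0 (nv i) vx.
have [|c cP] := @residue i (pi i y / pi i x).
  rewrite -(subrr n); apply: (nval_geM (nv i)) => //.
  by rewrite (nvalV (nv i) vx).
exists c; have := nval_geM (nv i) cP (y := pi i x) (n := n).
rewrite vx => /(_ (lexx _)); rewrite mulrBl divfK // addrC.
by rewrite rmorphB scale_iota rmorphM.
Qed.

(** This is the fractional ideal [t^alpha O~]. *)
Definition val_ge alpha : set K := [set h | forall i, ((alpha i)%:E <= vpi i h)%E].

Lemma subspace_val_ge alpha : subspace (val_ge alpha).
Proof.
split=> [i|c x y xP yP i]; first by rewrite rmorph0 (nval0 (nv i)) leey.
by rewrite rmorphD; apply: (nval_geD (nv i)) => //; apply: val_scale_ge.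
Qed.

Lemma val_ge_mono alpha beta : Zle alpha beta -> val_ge beta `<=` val_ge alpha.
Proof. by move=> ab h hP i; apply: le_trans (hP i); rewrite lee_fin. Qed.

Lemma val_geS alpha i h :
  val_ge (alpha + ei i) h <-> val_ge alpha h /\ ((alpha i + 1)%:E <= vpi i h)%E.
Proof.
split=> [hP|[hP hi] j].
  split=> [j|]; last by have := hP i; rewrite ffunE eiE eqxx.
  by apply: le_trans (hP j); rewrite lee_fin ffunE eiE lerDl ler0n.
by rewrite ffunE eiE; case: eqP => [->|_] //=; rewrite addr0.
Qed.

Lemma val_ge_iotaM alpha a h : val_ge alpha h -> val_ge alpha (iota a * h).
Proof.
move=> hP i; rewrite rmorphM -[alpha i]add0r.
by apply: (nval_geM (nv i)) => //; apply: val_iota_ge0.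
Qed.

Lemma submodule_val_ge alpha : is_submodule iota (val_ge alpha).
Proof.
have sV := subspace_val_ge alpha.
by split=> [|x y|a x]; [case: sV|apply: subspaceD|apply: val_ge_iotaM].
Qed.

Lemma val_geM alpha beta x y : val_ge alpha x -> val_ge beta y -> val_ge (alpha + beta) (x * y).
Proof.
by move=> xP yP i; rewrite rmorphM ffunE; apply: (nval_geM (nv i)).
Qed.

Lemma walk_filtration (b : nat -> Zr) (d : nat -> 'I_r) N :
  (forall s, (s < N)%N -> b s.+1 = b s + ei (d s)) ->
  line_filtration (fun s => val_ge (b s)) N.
Proof.
move=> bS; split=> [s|s sN h|s x y sN xs nxs ys]; first exact: subspace_val_ge.
  by rewrite bS // => /val_geS[].
rewrite bS //; have vx : vpi (d s) x = (b s (d s))%:E.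
  apply: contrapT => /(nval_ge_succ (nv (d s)) (xs (d s))) vx1.
  by apply: nxs; rewrite bS //; apply/val_geS.
have [c cP] := line_step vx (ys (d s)); exists c.
apply/val_geS; split=> //; apply: (subspaceB (subspace_val_ge _)) => //.
exact: (subspaceZ _ (subspace_val_ge _)).
Qed.

Definition val_eq x alpha := forall i, vpi i x = (alpha i)%:E.

Lemma val_eq_exists alpha : exists x, val_eq x alpha.
Proof.
have ex i : {y : L i | v y = (alpha i)%:E}.
  by apply: cid; apply: (nval_surj (nv i)).
have [x xP] := component_exists (fun i => sval (ex i)).
by exists x => i; rewrite xP; case: (ex i).
Qed.

Lemma value_setP (I : set K) alpha :
  value_set pi v I alpha <-> exists2 h, I h & val_eq h alpha.
Proof.
split=> [[h [Ih nz] <-]|[h Ih hP]].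
  exists h => // i; rewrite ffunE.
  have [|n ->] := @nval_fin _ _ _ (nv i) (pi i h); last by [].
  by apply/eqP => h0; apply: nz; exists i.
exists h; last by apply/ffunP => i; rewrite ffunE hP.
by split=> // -[i hi0]; have := hP i; rewrite hi0 (nval0 (nv i)).
Qed.

Lemma val_eqM alpha beta x y : val_eq x alpha -> val_eq y beta -> val_eq (x * y) (alpha + beta).
Proof. by move=> xa yb i; rewrite rmorphM ffunE; apply: (nvalM (nv i)). Qed.

Lemma divisible x y alpha beta : val_eq x alpha -> val_ge (alpha + beta) y ->
  exists2 z, val_ge beta z & y = x * z.
Proof.
move=> xa yP; have [z zP] := component_exists (fun i => pi i y / pi i x).
have xi0 i : pi i x != 0 by apply: (nval_neq0 (nv i) (xa i)).
exists z => [i|].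
  rewrite zP (_ : beta i = alpha i + beta i - alpha i); last by lia.
  by apply: (nval_geM (nv i)); [have := yP i; rewrite ffunE|rewrite (nvalV (nv i) (xa i))].
by apply: component_ext => i; rewrite rmorphM zP mulrC (divfK (xi0 i)).
Qed.

Lemma val_max_power i s a : max_power s a -> ((s%:Z)%:E <= vpi i (iota a))%E.
Proof.
move=> [n [f [u [nu ->]]]]; rewrite !rmorph_sum /=; apply: (nval_sum_ge (nv i)) => j.
rewrite !rmorphM /= -[_%:Z]add0r; apply: (nval_geM (nv i)); first exact: val_iota_ge0.
rewrite !rmorph_prod; apply: (nval_prod_ge (nv i)) => l.
exact: val_nonunit.
Qed.

(** * Conductor *)

Variable c : Zr.
Hypothesis condc : is_conductor (value_set pi v (range iota)) c.

Lemma value_ge_cond beta : Zle c beta -> exists a, val_eq (iota a) beta.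
Proof.
case: condc => -[_ /(_ beta) cS] _ /cS /value_setP [_ [a _ <-] aP].
by exists a.
Qed.

Lemma cond_ge0 i : 0 <= c i.
Proof.
have [|a aP] := value_ge_cond (beta := c); first by move=> j.
by have := val_iota_ge0 i a; rewrite aP lee_fin.
Qed.

(** One step of the walk at a time, the leading term of [h] along the current
    branch is cancelled by an element of [O]; every value above [c] is available. *)
Lemma approx_word (w : seq 'I_r) gamma h : Zle c gamma -> val_ge gamma h ->
  exists a, val_ge (gamma + word_end w) (h - iota a).
Proof.
elim: w gamma h => [|i w IH] gamma h cg hg.
  by exists 0; rewrite rmorph0 subr0 /word_end big_nil addr0.
have [b bP] := value_ge_cond cg.
have [l lP] := line_step (bP i) (hg i).
have [||a aP] := IH (gamma + ei i) (h - l *: iota b).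
- by move=> j; apply: le_trans (cg j) _; rewrite ffunE eiE lerDl ler0n.
- apply/val_geS; split=> //; apply: (subspaceB (subspace_val_ge _)) => //.
  by apply: (subspaceZ _ (subspace_val_ge _)) => j; rewrite bP.
exists (l *: b + a); rewrite linearD linearZ /= opprD addrA.
by rewrite /word_end big_cons addrA.
Qed.

(** Elements above [c] are expanded in powers of some [x] in the maximal
    ideal; completeness makes the expansion converge. *)
Lemma val_ge_cond_sub : val_ge c `<=` range iota.
Proof.
have [N cN] := exists_bound c.
have [|x xP] := value_ge_cond (beta := const_vec r N.+1%:Z).
  by move=> i; rewrite ffunE; have := cN i; lia.
have step h : exists p : O * K, val_ge c h -> val_ge c p.2 /\ h = iota p.1 + iota x * p.2.
  have [hc|nhc] := pselect (val_ge c h); last by exists (0, 0).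
  have [//|a aP] := approx_word (rounds r N.+1) (gamma := c) _ hc.
  rewrite word_end_rounds addrC in aP.
  have [z zc zE] := divisible xP aP.
  by exists (a, z) => _; split=> //=; rewrite -zE addrC subrK.
have [f fP] := choice step.
move=> h hc.
pose hs s := iter s (fun h => (f h).2) h.
have hsc s : val_ge c (hs s) by elim: s => //= s /fP[].
pose a s := \sum_(u < s) x ^+ u * (f (hs u)).1.
have hE s : h = iota (a s) + iota x ^+ s * hs s.
  elim: s => [|s {1}->]; first by rewrite /a big_ord0 rmorph0 add0r mul1r.
  rewrite {1}(fP _ (hsc s)).2 /a big_ord_recr /= rmorphD rmorphM rmorphXn.
  by rewrite mulrDr addrA mulrA -exprSr.
have [[i0 _]|noi] := pselect (exists i : 'I_r, True); last first.
  by exists 0 => //; apply: component_ext => i; case: noi; exists i.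
have nux : nonunit x.
  apply/negP => xu; have := val_iota_ge0 i0 x^-1.
  rewrite rmorphV // rmorphV ?rmorph_unit // (nvalV (nv i0) (xP i0)) lee_fin ffunE.
  by lia.
have [|b bP] := alg_complete (curve_ring curve) (a := a).
  move=> s; exists 1%N, (fun=> (f (hs s)).1), (fun _ _ => x); split=> //.
  by rewrite big_ord1 prodr_const card_ord /a big_ord_recr /= addrAC subrr add0r mulrC.
exists b => //; apply: component_ext => i; apply/eqP; rewrite -subr_eq0 -rmorphB /=.
apply/negPn/negP => nz; have [n vn] := nval_fin (nv i) nz.
suff : ((`|n|.+1%:Z)%:E <= vpi i (iota b - h)%R)%E by rewrite vn lee_fin; lia.
rewrite (hE `|n|.+1) opprD addrA -(rmorphB iota) (rmorphB (pi i)).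
apply: (nval_geB (nv i)); first exact: val_max_power.
rewrite rmorphM rmorphXn (nval_mul (nv i)) (nvalX (nv i) _ (xP i)) ffunE.
apply: (@le_trans _ _ ((N.+1%:Z * `|n|.+1%:Z + c i)%:E)).
  by rewrite lee_fin; have := cond_ge0 i; nia.
by rewrite EFinD; apply: leeD => //; apply: hsc.
Qed.


Lemma val_ge_cancel x y alpha beta : val_eq x alpha ->
  val_ge (alpha + beta) (x * y) -> val_ge beta y.
Proof.
move=> xa /(divisible xa) [z zb xyz]; rewrite (_ : y = z) //.
apply: component_ext => i; apply: (mulfI (nval_neq0 (nv i) (xa i))).
by rewrite -!rmorphM xyz.
Qed.

Lemma unit_val x : x \is a GRing.unit -> exists alpha, val_eq x alpha.
Proof.
move=> ux; have ex i : {n | vpi i x = n%:E}.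
  apply: cid; apply: (nval_fin (nv i)).
  by rewrite -unitfE rmorph_unit.
by exists [ffun i => sval (ex i)] => i; rewrite ffunE; case: (ex i).
Qed.

(** Such an [x] would make [c - e_i] absorbing: the components of [x] off [i] can
    be changed to anything of value at least [c_j] by adding an element of [K(c)]. *)
Lemma no_frob i x : range iota x -> vpi i x = (c i - 1)%:E ->
  (forall j, j != i -> ((c j)%:E <= vpi j x)%E) -> False.
Proof.
move=> Ox vx xc; case: condc => -[_ _] minc.
have absorb beta : Zle (c - ei i) beta -> value_set pi v (range iota) beta.
  move=> cb; have [ci|ci] := lerP (c i) (beta i).
    have [j|a aP] := value_ge_cond (beta := beta).
      have [->//|ji] := eqVneq j i.
      by have := cb j; rewrite sub_ei_neq.
    by apply/value_setP; exists (iota a) => //; exists a.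
  have bi : beta i = c i - 1.
    by have := cb i; rewrite sub_ei_eq; lia.
  have [t tP] := val_eq_exists beta.
  have [z zP] := component_exists (fun j => if j == i then 0 else pi j (t - x)).
  apply/value_setP; exists (x + z).
    case: Ox => a _ <-; have [|b _ <-] := @val_ge_cond_sub z; last first.
      by exists (a + b); rewrite ?rmorphD.
    move=> j; rewrite zP; case: eqP => [_|/eqP ji]; first by rewrite (nval0 (nv j)) leey.
    rewrite rmorphB; apply: (nval_geB (nv j)); last exact: xc.
    by rewrite tP lee_fin; have := cb j; rewrite sub_ei_neq.
  move=> j; rewrite rmorphD zP; case: eqP => [->|_]; first by rewrite addr0 vx bi.
  by rewrite rmorphB addrC subrK.
have /(_ i) : Zle c (c - ei i) by apply: minc; split; first by apply: absorb.
by rewrite sub_ei_eq; lia.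
Qed.

(** The product over [i] of integral equations of the components is an integral
    equation of [x]. *)
Lemma normalizationE : normalization iota = val_ge 0.
Proof.
apply/seteqP; split=> [x|x x0].
  by move=> xint i; rewrite ffunE; apply/(nval_ring (nv i)); apply: integral_rmorph.
have ex i : {p : {poly O} | p \is monic & root (map_poly (pi i \o iota) p) (pi i x)}.
  by apply: cid2; apply/(nval_ring (nv i)); have := x0 i; rewrite ffunE.
exists (\prod_i s2val (ex i)); first by apply: monic_prod => i _; case: (ex i).
apply/rootP/component_ext => i.
rewrite rmorph0 -horner_map -map_poly_comp rmorph_prod horner_prod (bigD1 i) //=.
by case: (ex i) => p pmon /= /rootP ->; rewrite mul0r.
Qed.

(** If [h] is in the conductor ideal and has finite values, all values above that
    of [h] are attained in [O], so the value of [h] is at least [c]. Zero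
    components of [h] are first filled in by an element [z] of [K(c)]. *)
Lemma conductor_idealE : conductor_ideal iota = val_ge c.
Proof.
apply/seteqP; rewrite /conductor_ideal normalizationE; split=> h hP; last first.
  by move=> y y0; apply: val_ge_cond_sub; rewrite -[c]addr0; apply: val_geM.
have [t tP] := val_eq_exists c.
have [z zP] := component_exists (fun i => if pi i h == 0 then pi i t else 0).
have zc : val_ge c z.
  by move=> i; rewrite zP; case: eqP => _; rewrite ?tP // (nval0 (nv i)) leey.
have nz i : pi i (h + z) != 0.
  rewrite rmorphD zP; case: (eqVneq (pi i h) 0) => [->|]; last by rewrite addr0.
  by rewrite add0r; apply: (nval_neq0 (nv i) (tP i)).
have ex i : {n | vpi i (h + z) = n%:E} by apply: cid; apply: (nval_fin (nv i) (nz i)).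
pose gamma : Zr := [ffun i => sval (ex i)].
have hzP : val_eq (h + z) gamma by move=> i; rewrite ffunE; case: (ex i).
have absorb beta : Zle gamma beta -> value_set pi v (range iota) beta.
  move=> gb; have [y yP] := val_eq_exists (beta - gamma).
  apply/value_setP; exists ((h + z) * y).
    have y0 : val_ge 0 y.
      by move=> i; rewrite yP lee_fin; have := gb i; rewrite !ffunE subr_ge0.
    have [a _ aE] := hP y y0.
    have [|b _ bE] := @val_ge_cond_sub (z * y).
      by rewrite -[c]addr0; apply: val_geM.
    by exists (a + b) => //; rewrite rmorphD /= aE bE mulrDl.
  by have := val_eqM hzP yP; rewrite [gamma + _]addrC subrK.
have cg : Zle c gamma by apply: condc.2; split=> //; apply: absorb.
move=> i; rewrite -[h](addrK z) rmorphB; apply: (nval_geB (nv i)) => //.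
by rewrite hzP lee_fin.
Qed.

(** * Jumps of a submodule *)

Local Notation lvl := (level pi v).

Definition hit (I : set K) beta i := exists2 h, lvl I beta h & vpi i h = (beta i)%:E.

Lemma levelS I alpha i h : lvl I (alpha + ei i) h <->
  lvl I alpha h /\ ((alpha i + 1)%:E <= vpi i h)%E.
Proof.
split=> [[Ih /val_geS[]]|[[Ih ha] hi]] //.
by split=> //; apply/val_geS.
Qed.

Lemma submodule_level I alpha : is_submodule iota I -> is_submodule iota (lvl I alpha).
Proof.
have [V0 VD VM] := submodule_val_ge alpha.
move=> [I0 ID IM]; split=> [|x y [Ix xa] [Iy ya]|a x [Ix xa]].
- by split.
- by split; [apply: ID|apply: VD].
- by split; [apply: IM|apply: VM].
Qed.

Lemma no_hitP I alpha i :
  ~ hit I alpha i <-> lvl I alpha `<=` lvl I (alpha + ei i).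
Proof.
split=> [nh h ha|sub [h ha hi]].
  apply/levelS; split=> //; apply: (nval_ge_succ (nv i)); first exact: ha.2.
  by move=> hi; apply: nh; exists h.
by move: (sub h ha) => /levelS[_]; rewrite hi lee_fin; lia.
Qed.

Lemma ell0P I alpha i : is_submodule iota I ->
  ell iota pi v I alpha i 0 <-> ~ hit I alpha i.
Proof.
move=> sI; split=> [[M [M0 M1 _ _]]|/no_hitP sub].
  by apply/no_hitP; rewrite -[lvl I alpha]M1 M0.
exists (fun=> lvl I (alpha + ei i)); split=> // [|_ _]; last exact: submodule_level.
by apply/seteqP; split=> // h /levelS[].
Qed.

(** A jump has a one-dimensional quotient, the residue field being [k]: no
    submodule fits strictly in between. *)
Lemma ell1P I alpha i : is_submodule iota I ->
  ell iota pi v I alpha i 1 <-> hit I alpha i.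
Proof.
move=> sI; split=> [[M [M0 M1 _ /(_ 0%N isT) [[_ nsub] _]]]|[x xa xi]].
  by apply: contrapT => /no_hitP; rewrite -[lvl I alpha]M1 -[lvl _ (_ + _)]M0.
have subl : lvl I (alpha + ei i) `<=` lvl I alpha by move=> h /levelS[].
exists (fun j : nat => if j is 0%N then lvl I (alpha + ei i) else lvl I alpha).
split=> // [[|j] _|[|//] _]; try exact: submodule_level.
split; first by split=> // /(_ x xa) /levelS[_]; rewrite xi lee_fin; lia.
move=> M [M0 MD MM] BM MA; have [MB|nMB] := pselect (M `<=` lvl I (alpha + ei i)).
  by left; apply/seteqP.
right; apply/seteqP; split=> // y ya.
move/existsNP: nMB => [z /not_implyP [Mz nBz]].
have zi : vpi i z = (alpha i)%:E.
  apply: contrapT => nzi; apply: nBz; apply/levelS; split; first exact: MA.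
  by apply: (nval_ge_succ (nv i)) nzi; exact: (MA z Mz).2.
have [l lP] := line_step zi (ya.2 i).
have Mlz : M (l *: z) by rewrite scale_iota; apply: MM.
rewrite -[y](subrK (l *: z)); apply: MD => //; apply: BM; apply/levelS; split=> //.
have [L0 LD LM] := submodule_level alpha sI.
rewrite -scaleNr scale_iota; apply: LD => //; apply: LM; exact: MA.
Qed.

(** If [h] and [g] realise the two jumps, then [g h] lies in [O] and has value
    [c_i - 1] at [i] and at least [c_j] elsewhere. *)
Lemma dual_hit I beta i : hit I beta i -> hit (dual iota I) (c - beta - ei i) i -> False.
Proof.
move=> [h [Ih hb] hi] [g [gI gb] gi].
apply: (@no_frob i (g * h)) => [||j ji]; first exact: gI.
  rewrite rmorphM (nvalM (nv i) gi hi) sub_ei_eq !ffunE.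
  by congr (_%:E); ring.
rewrite rmorphM (_ : c j = (c - beta - ei i) j + beta j); last first.
  by rewrite sub_ei_neq // !ffunE subrK.
exact: (nval_geM (nv j)).
Qed.

Lemma submodule_range : is_submodule iota (range iota).
Proof.
split=> [|_ _ [a _ <-] [b _ <-]|b _ [a _ <-]].
- by exists 0; rewrite ?rmorph0.
- by exists (a + b); rewrite ?rmorphD.
- by exists (b * a); rewrite ?rmorphM.
Qed.

Lemma submodule_dual I : is_submodule iota (dual iota I).
Proof.
have [O0 OD OM] := submodule_range.
split=> [y _|x y xI yI z Iz|a x xI z Iz]; first by rewrite mul0r.
  by rewrite mulrDl; apply: OD; [apply: xI|apply: yI].
by rewrite -mulrA; apply: OM; apply: xI.
Qed.

(** * The inequality *)

Lemma p_le I alpha : (p_ iota pi v I alpha <= r)%N.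
Proof. by apply/bigmax_leqP_seq => n; rewrite mem_index_iota ltnS. Qed.

Lemma p_holds I alpha : p_cond iota pi v I alpha (p_ iota pi v I alpha).
Proof.
apply: big_ind => [J|m n pm pn|n /asboolP //].
  by rewrite leqn0 cards_eq0 => /eqP -> i; rewrite inE.
by case: (leqP m n) => _.
Qed.

Lemma p_max I alpha n : (n <= r)%N -> p_cond iota pi v I alpha n ->
  (n <= p_ iota pi v I alpha)%N.
Proof.
move=> nr pn; apply: (bigmaxn_sup_seq n) => //; last exact/asboolP.
by rewrite mem_index_iota.
Qed.

Lemma q_ge1 I alpha : (1 <= q_ iota pi v I alpha)%N.
Proof.
rewrite /q_ big_seq_cond.
apply: (big_ind (fun m => (1 <= m)%N)) => // [m n|n].
  by rewrite leq_min => -> ->.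
by rewrite mem_index_iota => /andP[/andP[]].
Qed.

Lemma q_holds I alpha : q_cond iota pi v I alpha (q_ iota pi v I alpha).
Proof.
apply: big_ind => [J|m n pm pn|n /asboolP //].
  by move=> rJ; have := max_card (mem J); rewrite card_ord leqNgt rJ.
by case: (leqP m n) => _.
Qed.

Lemma q_min I alpha n : (1 <= n <= r.+1)%N -> q_cond iota pi v I alpha n ->
  (q_ iota pi v I alpha <= n)%N.
Proof.
move=> nr qn; rewrite /q_.
have : n \in index_iota 1 r.+2 by rewrite mem_index_iota ltnS.
elim: (index_iota _ _) => // m s IH; rewrite inE => /orP[/eqP <-|/IH le].
  by rewrite big_cons asboolT // geq_minl.
rewrite big_cons; case: ifP => // _.
by apply: leq_trans le; rewrite geq_minr.
Qed.

(** The partner of [J] at [i] under duality: [pivot_shift] is the reason for this choice. *)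
Definition pivot i (J : {set 'I_r}) : {set 'I_r} := (i |: ~: J)%SET.

Lemma pivotK i (J : {set 'I_r}) : i \in J -> pivot i (pivot i J) = J.
Proof.
by move=> iJ; apply/setP => j; rewrite !inE; case: eqP => [->|_] //=; rewrite negbK.
Qed.

Lemma card_pivot i (J : {set 'I_r}) : i \in J -> (#|pivot i J| + #|J| = r.+1)%N.
Proof.
by move=> iJ; rewrite cardsU1 !inE iJ -addnA [(#|~: J| + _)%N]addnC cardsC card_ord.
Qed.

Lemma pivot_shift alpha i (J : {set 'I_r}) : i \in J ->
  frob c - alpha + e_ (~: J) = c - (alpha + e_ (~: pivot i J)) - ei i.
Proof.
move=> iJ; apply/ffunP => j; rewrite !ffunE !inE.
by case: eqP => [->|_] /=; rewrite ?iJ ?negbK /=; case: (j \in J) => /=; ring.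
Qed.

(** If [p < r], some [J] with at most [p + 1] elements has a jump; by duality its
    partner, which has at least [r - p] elements, has none in the dual. *)
Lemma p_q_ge I alpha : is_submodule iota I ->
  (r.+1 <= p_ iota pi v I alpha + q_ iota pi v (dual iota I) (frob c - alpha)%R)%N.
Proof.
move=> sI; set p := p_ _ _ _ _ _; set q := q_ _ _ _ _ _.
have := p_le I alpha; rewrite -/p leq_eqVlt => /orP[/eqP ->|pr].
  by rewrite -addn1 leq_add2l; apply: q_ge1.
rewrite leqNgt; apply/negP => pq.
have : ~ p_cond iota pi v I alpha p.+1.
  by move=> /p_max-/(_ pr); rewrite -/p ltnn.
apply=> J Jp i iJ; apply/ell0P => // hitI.
have iJ' : i \in pivot i J by rewrite !inE eqxx.
have qJ' : (q <= #|pivot i J|)%N by have := card_pivot iJ; lia.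
have := q_holds qJ' iJ'; rewrite (pivot_shift _ iJ') (pivotK iJ).
move=> /ell1P => /(_ (submodule_dual I)).
exact: dual_hit hitI.
Qed.

(** * Symmetry and the equality *)

(** One half of [ell_A(b, i) + ell_B(c - b - e_i, i) = 1]; when [B] is the dual of
    [A], the other half is [dual_hit]. *)
Definition symmetric_pair (A B : set K) :=
  forall beta i, ~ hit A beta i -> hit B (c - beta - ei i) i.

Lemma p_q_eq I alpha : is_submodule iota I -> symmetric_pair I (dual iota I) ->
  (p_ iota pi v I alpha + q_ iota pi v (dual iota I) (frob c - alpha)%R)%N = r.+1.
Proof.
move=> sI symI; apply/eqP; rewrite eqn_leq p_q_ge // andbT.
have pr := p_le I alpha; have pP := @p_holds I alpha.
move: (p_ _ _ _ _ _) pr pP => p pr pP.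
rewrite -leq_subRL; last exact: leqW.
apply: q_min => [|J' nJ' i iJ']; first by lia.
apply/ell1P; first exact: submodule_dual.
have iJ : i \in pivot i J' by rewrite !inE eqxx.
rewrite (pivot_shift _ iJ'); apply: symI; apply/ell0P => //.
by apply: pP => //; have := card_pivot iJ'; lia.
Qed.

Lemma dual_range : dual iota (range iota) = range iota.
Proof.
apply/seteqP; split=> [x xP|_ [a _ <-] _ [b _ <-]].
  by rewrite -[x]mulr1 -(rmorph1 iota); apply: xP; exists 1.
by exists (a * b); rewrite ?rmorphM.
Qed.

(** The case of the singleton [J = {i}] in the condition that defines [p]. *)
Definition strict_jump alpha i := hit (range iota) (alpha + e_ (~: [set i])%SET) i.

(** Below a value [beta] that is not attained at [i] there is [alpha], with the
    same [i]-th component, at which no branch jumps: lower the other components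
    as long as the gap at [i] persists. When it no longer does along [l], an
    element [g] attains it, and an [h] jumping at [l] could be used to cancel
    the [l]-th leading term of [g]. *)
Lemma gap_descends beta i : ~ hit (range iota) beta i ->
  exists2 alpha : Zr, alpha i = beta i /\ (forall j, j != i -> alpha j < beta j) &
    forall l, ~ strict_jump alpha l.
Proof.
move=> gap.
have shiftE (alpha : Zr) l j : (alpha + e_ (~: [set l])%SET) j = alpha j + (j != l)%:R.
  by rewrite !ffunE !inE.
pose good (alpha : Zr) := [/\ alpha i = beta i, forall j, j != i -> alpha j < beta j &
  ~ strict_jump alpha i].
suff descend n : forall alpha : Zr, good alpha ->
    (\sum_j `|Num.max (alpha j + 1)%R 0| < n)%N ->
    exists2 a : Zr, a i = beta i /\ (forall j, j != i -> a j < beta j) &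
      forall l, ~ strict_jump a l.
  (* the least lowering of beta off i: alpha + e_(~: [set i]) is beta itself *)
  pose alpha := beta - [ffun j => (j != i)%:R].
  apply: (descend _ alpha _ (ltnSn _)); split=> [|j ji|].
  - by rewrite !ffunE eqxx subr0.
  - by rewrite !ffunE ji ltrBlDr ltrDl.
  - rewrite /strict_jump (_ : alpha + _ = beta) //; apply/ffunP => j.
    by rewrite shiftE !ffunE subrK.
(* negative components contribute nothing to the measure, as O has no negative values *)
elim: n => // n IH alpha [ai aj agap] lt.
have [[l [li al0 lgap]]|none] := pselect (exists l,
    [/\ l != i, 0 <= alpha l & ~ strict_jump (alpha - ei l) i]).
  apply: (IH (alpha - ei l)).
    split=> // [|j ji]; first by rewrite sub_ei_neq // eq_sym.
    have [->|jl] := eqVneq j l; last by rewrite sub_ei_neq // aj.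
    by rewrite sub_ei_eq; have := aj l li; lia.
  rewrite -ltnS; apply: leq_trans lt; rewrite ltnS.
  rewrite (bigD1 l) //= [X in (_ < X)%N](bigD1 l) //= sub_ei_eq -addSn.
  apply: leq_add; first by lia.
  by apply: leq_sum => j jl; rewrite sub_ei_neq.
exists alpha => // l; have [->//|li] := eqVneq l i.
move=> [h [Oh hge] hl]; have hl' : vpi l h = (alpha l)%:E.
  by rewrite hl shiftE eqxx addr0.
have al0 : 0 <= alpha l.
  by case: Oh hl' => a _ <-; have := val_iota_ge0 l a => + ha; rewrite ha lee_fin.
have : strict_jump (alpha - ei l) i.
  by apply: contrapT => nj; apply: none; exists l.
move=> [g [Og gge] gi].
have gl : ((alpha l)%:E <= vpi l g)%E.
  by have := gge l; rewrite shiftE sub_ei_eq li subrK.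
have [a la] := line_step hl' gl.
apply: agap; exists (g - a *: h).
  split.
    have [O0 OD OM] := submodule_range.
    by rewrite -scaleNr scale_iota; apply: OD => //; apply: OM.
  move=> j; rewrite shiftE; have [->|jl] := eqVneq j l; first by rewrite li.
  rewrite rmorphB; apply: (nval_geB (nv j)).
    by have := gge j; rewrite shiftE sub_ei_neq.
  apply: val_scale_ge; have := hge j; rewrite shiftE jl.
  by apply: nval_ge_le; case: eqP => _; rewrite ?addr0 // lerDl.
move: gi; rewrite !shiftE eqxx !addr0 sub_ei_neq 1?eq_sym // => gi.
rewrite rmorphB; apply: (nval_eqD (nv i) gi); rewrite (nvalN (nv i)).
by apply: val_scale_ge; have := hge i; rewrite shiftE eq_sym li.
Qed.

(** At the [alpha] of [gap_descends] one has [p >= 1], hence [q <= r], and the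
    condition of [q] for the full index set yields the required element. *)
Lemma symmetric_of_equality :
  (forall alpha, (p_ iota pi v (range iota) alpha +
     q_ iota pi v (dual iota (range iota)) (frob c - alpha)%R)%N = r.+1) ->
  symmetric_pair (range iota) (range iota).
Proof.
move=> eqO beta i gap; have [alpha [ai aj] nojump] := gap_descends gap.
have sO := submodule_range.
have r0 : (0 < r)%N by apply: leq_ltn_trans (ltn_ord i).
have p1 : (1 <= p_ iota pi v (range iota) alpha)%N.
  apply: p_max => // J J1 l lJ; apply/ell0P => //.
  suff -> : J = [set l]%SET by apply: nojump.
  by apply/esym/eqP; rewrite eqEcard finset.sub1set lJ cards1.
have := eqO alpha; rewrite dual_range => /eqP.
set q := q_ _ _ _ _ _ => pq.
have qr : (q <= #|[set: 'I_r]%SET|)%N by rewrite cardsT card_ord; move/eqP: pq; lia.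
have /(ell1P _ _ sO) [h [Oh hge] hi] := q_holds qr (finset.in_setT i).
have fE j : (frob c - alpha + e_ (~: [set: 'I_r])%SET) j = c j - 1 - alpha j.
  by rewrite !ffunE !inE addr0.
have bE j : (c - beta) j = c j - beta j by rewrite !ffunE.
exists h.
  split=> // j; have := hge j; rewrite fE; apply: (nval_ge_le (w := @v j)).
  have [->|ji] := eqVneq j i; first by rewrite sub_ei_eq bE ai; lia.
  by rewrite sub_ei_neq // bE; have := aj j ji; lia.
by rewrite hi fE sub_ei_eq bE ai addrAC.
Qed.

(** * Counting jumps along a walk *)

Section Walk.
Variables (N : nat) (b : nat -> Zr) (d : nat -> 'I_r).
Hypothesis bS : forall s, (s < N)%N -> b s.+1 = b s + ei (d s).

Definition hits (A : set K) := (\sum_(s < N) `[< hit A (b s) (d s) >])%N.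

(** These are the jumps along the mirrored walk from [c - b N] to [c - b 0],
    indexed by the steps of [b] so as to be compared with [hits] term by term. *)
Definition cohits (A : set K) :=
  (\sum_(s < N) `[< hit A (c - b s - ei (d s))%R (d s) >])%N.

Let F s := val_ge (b s).
Let F' s := val_ge (c - b (N - s)%N).

Lemma filtration_hits : line_filtration F N.
Proof. exact: (walk_filtration bS). Qed.

Lemma cowalk s : (s < N)%N ->
  c - b (N - s.+1) = c - b (N - s)%N + ei (d (N - s.+1)).
Proof.
move=> sN; have -> : (N - s = (N - s.+1).+1)%N by lia.
by rewrite bS; [rewrite opprD addrA subrK|lia].
Qed.

Lemma filtration_cohits : line_filtration F' N.
Proof.
exact: (walk_filtration (b := fun s => c - b (N - s)%N)
  (d := fun s => d (N - s.+1)%N) cowalk).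
Qed.

Lemma hit_jump A beta i :
  `[< exists h, [/\ A h, val_ge beta h & ~ val_ge (beta + ei i) h] >] = `[< hit A beta i >].
Proof.
apply/asboolP/asboolP => [[h [Ah hb nh]]|[h [Ah hb] hi]].
  exists h => //; apply: contrapT => nhi; apply: nh; apply/val_geS; split=> //.
  exact: (nval_ge_succ (nv i)).
by exists h; split=> // /val_geS[_]; rewrite hi lee_fin; lia.
Qed.

Lemma hitsE A : hits A = jumps F N A.
Proof.
by apply: eq_bigr => s _; rewrite /jump /F bS // hit_jump.
Qed.

Lemma cohitsE A : cohits A = jumps F' N A.
Proof.
rewrite /jumps (reindex_inj rev_ord_inj) /=; apply: eq_bigr => s _.
have sN := ltn_ord s.
rewrite /jump /F' cowalk; last by lia.
rewrite (_ : (N - (N - s.+1) = s.+1)%N); last by lia.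
rewrite (_ : (N - (N - s.+1).+1 = s)%N); last by lia.
by rewrite bS // opprD addrA hit_jump.
Qed.

Lemma hits_val_ge gamma : (hits (val_ge gamma) + cohits (val_ge (c - gamma)%R))%N = N.
Proof.
have hitP (a : Zr) beta i : hit (val_ge a) beta i <-> a i <= beta i.
  split=> [[h [ha _] hi]|ab]; first by have := ha i; rewrite hi lee_fin.
  have [t tP] := val_eq_exists [ffun j => Num.max (a j) (beta j)].
  exists t; last by rewrite tP ffunE; congr (_%:E); apply/max_idPr.
  by split=> j; rewrite tP lee_fin ffunE le_max lexx ?orbT.
rewrite -big_split /= -[RHS]card_ord -sum1_card; apply: eq_bigr => s _.
rewrite !(asbool_equiv_eq (hitP _ _ _)) !asboolb sub_ei_eq !ffunE.
by case: lerP => /= H1; case: lerP => /= H2 //; exfalso; lia.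
Qed.

Lemma hits_dual_le I : (hits I + cohits (dual iota I) <= N)%N.
Proof.
rewrite -big_split /= -[X in (_ <= X)%N]card_ord -sum1_card; apply: leq_sum => s _.
case: asboolP => // h1; case: asboolP => // h2; case: (dual_hit h1 h2).
Qed.

Lemma hits_dual_eq I s : (s < N)%N -> (N <= hits I + cohits (dual iota I))%N ->
  ~ hit I (b s) (d s) -> hit (dual iota I) (c - b s - ei (d s)) (d s).
Proof.
move=> sN + nh; rewrite -big_split /= => le; apply: contrapT => nh'.
move: le; rewrite leqNgt => /negP; apply.
rewrite -[X in (_ < X)%N]card_ord -sum1_card (bigD1 (Ordinal sN)) //=.
rewrite [X in (_ < X)%N](bigD1 (Ordinal sN)) //= !asboolF // -addSn.
apply: leq_add => //; apply: leq_sum => u _.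
by case: asboolP => // h1; case: asboolP => // h2; case: (dual_hit h1 h2).
Qed.

Lemma hits_symmetric : symmetric_pair (range iota) (range iota) ->
  (hits (range iota) + cohits (range iota) = N)%N.
Proof.
move=> symO; apply/eqP; rewrite eqn_leq; apply/andP; split.
  by have := hits_dual_le (range iota); rewrite dual_range.
rewrite -big_split /= -[X in (X <= _)%N]card_ord -sum1_card; apply: leq_sum => s _.
by case: asboolP => // /symO h; rewrite asboolT.
Qed.

End Walk.

(** * The Gorenstein condition as symmetry *)

Lemma exists_walk beta i (lo up : Zr) :
  exists N (b : nat -> Zr) (d : nat -> 'I_r) s,
  [/\ forall s, (s < N)%N -> b s.+1 = b s + ei (d s),
      [/\ (s < N)%N, b s = beta & d s = i], Zle (b 0%N) lo & Zle up (b N)].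
Proof.
have [M1 M1P] := exists_bound (beta - lo).
have [M2 M2P] := exists_bound (up - beta).
(* M1 rounds climb from beta - M1 to beta, and M2 more lead beyond up *)
pose w := rounds r M1 ++ i :: rounds r M2.
pose b s := beta - const_vec r M1%:Z + word_end (take s w).
exists (size w), b, (nth i w), (size (rounds r M1)); split.
- move=> s sw; rewrite /b (take_nth i sw) /word_end -cats1 big_cat big_seq1.
  by rewrite addrA.
- split; first by rewrite size_cat /= addnS ltnS leq_addr.
    by rewrite /b take_size_cat // word_end_rounds subrK.
  by rewrite nth_cat ltnn subnn.
- move=> j; rewrite /b take0 /word_end big_nil addr0.
  by have := M1P j; rewrite !ffunE lerBlDr lerBlDl.
- move=> j; rewrite /b take_size /word_end big_cat big_cons -!/(word_end _) !word_end_rounds.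
  rewrite addrA subrK; have := M2P j; rewrite !ffunE inE lerBlDr => /le_trans; apply.
  have aux (x y z : int) : 0 <= y -> x + z <= z + (y + x) by lia.
  by apply: aux; rewrite ler0n.
Qed.

Lemma dual_sub_val_ge gamma I : val_ge gamma `<=` I ->
  dual iota I `<=` val_ge (c - gamma).
Proof.
move=> gI y yI; have [t tP] := val_eq_exists gamma.
apply: (val_ge_cancel tP); rewrite addrC subrK -conductor_idealE /conductor_ideal.
rewrite normalizationE => w w0; rewrite (_ : t * y * w = y * (t * w)); last by ring.
apply: yI; apply: gI; rewrite -[gamma]addr0; apply: val_geM => // i.
by rewrite tP.
Qed.

Lemma val_ge_sub_dual gamma : val_ge (c - gamma) `<=` dual iota (val_ge gamma).
Proof.
move=> x xc y yg; apply: val_ge_cond_sub; rewrite -[c](subrK gamma).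
exact: val_geM.
Qed.

Lemma subspace_submodule (M : set K) : is_submodule iota M -> subspace M.
Proof.
by move=> [M0 MD MM]; split=> // a x y Mx My; rewrite scale_iota; apply: MD => //; apply: MM.
Qed.

Lemma exists_branch : exists i : 'I_r, True.
Proof.
apply: contrapT => none; have /eqP := oner_neq0 K; apply.
by apply: component_ext => i; case: none; exists i.
Qed.

Lemma range_sub_val_ge (lo : Zr) : Zle lo 0 -> range iota `<=` val_ge lo.
Proof.
move=> lo0 _ [a _ <-] i; apply: le_trans (val_iota_ge0 i a).
by rewrite lee_fin; have := lo0 i; rewrite ffunE.
Qed.

Lemma range_sub_normalization : range iota `<=` val_ge 0.
Proof. by apply: range_sub_val_ge => i. Qed.

Section WalkCounts.
Variables (N : nat) (b : nat -> Zr) (d : nat -> 'I_r).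
Hypothesis bS : forall s, (s < N)%N -> b s.+1 = b s + ei (d s).
Hypotheses (b0 : Zle (b 0%N) 0) (bN : Zle c (b N)).

Local Notation fH := (filtration_hits bS).
Local Notation fC := (filtration_cohits bS).

Lemma co_start : Zle (c - b (N - 0)%N) 0.
Proof. by move=> i; rewrite subn0 !ffunE subr_le0. Qed.

Lemma co_end : Zle c (c - b (N - N)%N).
Proof. by move=> i; rewrite subnn !ffunE; have := b0 i; rewrite ffunE lerBrDr gerDl. Qed.

Lemma cohits_quot_dim (A B : set K) n : subspace A -> subspace B -> B `<=` A ->
  A `<=` val_ge 0 -> val_ge c `<=` B -> quot_dim A B n -> cohits N b d A = (cohits N b d B + n)%N.
Proof.
move=> sA sB BA A0 cB; rewrite !(cohitsE bS); apply: (quot_dim_jumps fC) => //.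
  exact: subset_trans (val_ge_mono co_start).
exact: subset_trans (val_ge_mono co_end) _.
Qed.

Lemma hits_quot_dim (A B : set K) n : subspace A -> subspace B -> B `<=` A ->
  A `<=` val_ge 0 -> val_ge c `<=` B -> quot_dim A B n -> hits N b d A = (hits N b d B + n)%N.
Proof.
move=> sA sB BA A0 cB; rewrite !(hitsE bS); apply: (quot_dim_jumps fH) => //.
  exact: subset_trans (val_ge_mono b0).
exact: subset_trans (val_ge_mono bN) _.
Qed.

(** With [n1 = dim O/C] and [n2 = dim O~/O], the jumps of [C] and [O~] along
    the walk and its reverse are complementary, so those of [O] on both walks
    add up to [N + n1 - n2]. *)
Lemma hits_range_quot_dim n1 n2 :
  quot_dim (range iota) (val_ge c) n1 -> quot_dim (val_ge 0) (range iota) n2 ->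
  (hits N b d (range iota) + cohits N b d (range iota) + n2 = N + n1)%N.
Proof.
have sO := subspace_submodule submodule_range.
have s0 := subspace_val_ge 0; have sc := subspace_val_ge c.
have O0 := range_sub_normalization; have cO := val_ge_cond_sub.
move=> q1 q2.
have h1 := hits_quot_dim sO sc cO O0 (fun x => id) q1.
have h2 := hits_quot_dim s0 sO O0 (fun x => id) cO q2.
have h3 := cohits_quot_dim sO sc cO O0 (fun x => id) q1.
have := hits_val_ge N b d 0; rewrite subr0; lia.
Qed.

End WalkCounts.

Lemma symmetric_of_gorenstein : gorenstein iota ->
  symmetric_pair (range iota) (range iota).
Proof.
move=> [n []]; rewrite conductor_idealE normalizationE => q1 q2 beta i gap.
have [N [b [d [s [bS [sN bs ds] b0 bN]]]]] := exists_walk beta i 0 c.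
have := hits_range_quot_dim bS b0 bN q1 q2 => /addIn hE.
rewrite -[in X in hit X]dual_range -bs -ds; apply: (hits_dual_eq sN).
  by rewrite dual_range hE.
by rewrite bs ds.
Qed.

Lemma gorenstein_of_symmetric : symmetric_pair (range iota) (range iota) ->
  gorenstein iota.
Proof.
move=> symO; have [i _] := exists_branch.
have [N [b [d [s [bS _ b0 bN]]]]] := exists_walk 0 i 0 c.
have fH := filtration_hits bS.
have sO := subspace_submodule submodule_range.
have O0 := range_sub_normalization; have cO := val_ge_cond_sub.
have b0' := val_ge_mono b0; have bN' := val_ge_mono bN.
have [n1 q1] := quot_dim_exists fH sO (subspace_val_ge c) cO
  (subset_trans O0 b0') bN'.
have [n2 q2] := quot_dim_exists fH (subspace_val_ge 0) sO O0 b0'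
  (subset_trans bN' cO).
exists n1; rewrite conductor_idealE normalizationE; split=> //.
have := hits_range_quot_dim bS b0 bN q1 q2.
by rewrite (hits_symmetric _ _ _ symO) => /addnI <-.
Qed.

(** * Symmetry of all fractional ideals *)

Definition max_ideal : set K := [set iota a | a in [set a | nonunit a]].

Lemma nonunit0 : nonunit (0 : O).
Proof. by rewrite /nonunit unitr0. Qed.

Lemma submodule_max_ideal : is_submodule iota max_ideal.
Proof.
split=> [|_ _ [a na <-] [b nb <-]|b _ [a na <-]].
- by exists 0; rewrite ?rmorph0 //=; exact: nonunit0.
- exists (a + b); rewrite ?rmorphD //=; exact: (alg_local (curve_ring curve)).
- by exists (b * a); rewrite ?rmorphM //=; apply: nonunitMl.
Qed.

Lemma val_ge_sub_max_ideal gamma : Zle c gamma -> (exists i, 1 <= gamma i) ->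
  val_ge gamma `<=` max_ideal.
Proof.
move=> cg [i gi] h hg; have [a _ ha] := val_ge_cond_sub (val_ge_mono cg hg).
exists a => //=; apply/negP => ua; have := val_iota_ge0 i a^-1.
have := hg i; rewrite -ha; have /(nval_fin (nv i)) [n vn] : pi i (iota a) != 0.
  by rewrite -unitfE !rmorph_unit.
by rewrite !rmorphV ?rmorph_unit // (nvalV (nv i) vn) vn !lee_fin; lia.
Qed.

(** The type-one property: [m^*/O] is at most a line, because [m] has one jump
    fewer than [O] and so [m^*] at most one more than [O]. *)
Lemma dual_max_ideal_line y z : symmetric_pair (range iota) (range iota) ->
  dual iota max_ideal y -> dual iota max_ideal z -> ~ range iota y ->
  exists l : k, range iota (z - l *: y).
Proof.
move=> symO my mz nOy; have [i _] := exists_branch.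
(* above c + 1 every element lies in O and is not a unit *)
pose one_c : Zr := c + const_vec r 1.
have [N [b [d [s [bS _ b0 bN]]]]] := exists_walk 0 i 0 one_c.
have cN : Zle c (b N).
  by move=> j; apply: le_trans (bN j); rewrite !ffunE lerDl.
have mN : val_ge (b N) `<=` max_ideal.
  apply: val_ge_sub_max_ideal => //; exists i; apply: le_trans (bN i).
  by rewrite !ffunE lerDr; apply: cond_ge0.
have fC := filtration_cohits bS.
have sO := subspace_submodule submodule_range.
have sm := subspace_submodule submodule_max_ideal.
have sd := subspace_submodule (submodule_dual max_ideal).
have Om : (hits N b d (range iota) <= (hits N b d max_ideal).+1)%N.
  rewrite !(hitsE bS); apply: leq_trans (jumps_adjoin_le (filtration_hits bS) 1 sm).
  apply: jumps_mono => _ [a _ <-]; have [l nl] := alg_coef_field (curve_ring curve) a.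
  by exists l, (a - l%:A) => //; rewrite rmorphB /= rmorph_alg.
have OE := hits_symmetric N b d symO.
have mE := hits_dual_le N b d max_ideal.
have le : (cohits N b d (dual iota max_ideal) <= (cohits N b d (range iota)).+1)%N by lia.
have F0 : dual iota max_ideal `<=` val_ge (c - b (N - 0)%N).
  by rewrite subn0; apply: dual_sub_val_ge.
have O0 : range iota `<=` val_ge (c - b (N - 0)%N).
  by apply: range_sub_val_ge; apply: co_start.
have FN : val_ge (c - b (N - N)%N) `<=` range iota.
  by apply: subset_trans val_ge_cond_sub; apply: val_ge_mono; apply: co_end.
have Od : range iota `<=` dual iota max_ideal.
  move=> _ [a _ <-] _ [e _ <-]; exists (a * e) => //.
  by rewrite rmorphM.
suff /(_ z mz) [l lP] : dual iota max_ideal `<=` adjoin (range iota) y by exists l.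
rewrite !(cohitsE bS) in le.
apply: (jumps_eq_sub fC) => //.
- exact: subspace_adjoin.
- exact: adjoin_sub.
- by move=> x [_ /FN Ox]; apply: sub_adjoin.
- by rewrite (jumps_adjoin fC) //; apply: F0.
Qed.

Lemma submodule_adjoin B x : is_submodule iota B ->
  (forall a, nonunit a -> B (iota a * x)) -> is_submodule iota (adjoin B x).
Proof.
move=> sB Bm; have sB' := subspace_submodule sB.
have [A0 AZD] := subspace_adjoin x sB'.
split=> // [y z Ay Az|a y [l By]]; first by rewrite -[y]scale1r; apply: AZD.
have [e ne] := alg_coef_field (curve_ring curve) a.
have -> : iota a * y = l *: (iota (a - e%:A) * x + e *: x) + iota a * (y - l *: x).
  rewrite rmorphB /= mulrBl -scale_iota subrK mulrBr scalerAr.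
  by rewrite [in RHS]addrC subrK.
apply: (AZD); last by apply: sub_adjoin; case: sB => _ _; apply.
rewrite addrC; apply: AZD; first exact: mem_adjoin.
by apply: sub_adjoin; apply: Bm.
Qed.

(** Adding [x] to [B] shrinks the dual by at most a line, since
    multiplication by [x] embeds the quotient of the duals into [m^*/O]. *)
Lemma dual_adjoin_line B x : symmetric_pair (range iota) (range iota) ->
  is_submodule iota B -> (forall a, nonunit a -> B (iota a * x)) ->
  exists y, dual iota B `<=` adjoin (dual iota (adjoin B x)) y.
Proof.
move=> symO sB Bm; have sB' := subspace_submodule sB.
have [O0 OD OM] := submodule_range.
have to_dual w : dual iota B w -> range iota (w * x) -> dual iota (adjoin B x) w.
  move=> wB wx u [l ul]; rewrite -[u](subrK (l *: x)) mulrDr; apply: OD; first exact: wB.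
  by rewrite -scalerAr scale_iota; apply: OM.
have to_max w : dual iota B w -> dual iota max_ideal (w * x).
  by move=> wB _ [a na <-]; rewrite -mulrA [x * _]mulrC; apply: wB; apply: Bm.
have [[y [By nOy]]|none] := pselect (exists y, dual iota B y /\ ~ range iota (y * x)).
  exists y => z Bz; have [l Ol] := dual_max_ideal_line symO (to_max y By) (to_max z Bz) nOy.
  exists l; apply: to_dual; last by rewrite mulrBl -scalerAl.
  exact: (subspaceB (subspace_submodule (submodule_dual B)) Bz
    (subspaceZ _ (subspace_submodule (submodule_dual B)) By)).
exists 0 => z Bz; apply: sub_adjoin; apply: to_dual => //.
by apply: contrapT => nz; apply: none; exists z.
Qed.

Section Chain.
Variables (N : nat) (b : nat -> Zr) (d : nat -> 'I_r).
Hypothesis bS : forall s, (s < N)%N -> b s.+1 = b s + ei (d s).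
Hypothesis symO : symmetric_pair (range iota) (range iota).

(** Along a chain of simple steps from [B] to [A] each step adds one jump and
    costs the dual at most one. The steps exist since [m] pushes every element of
    the last layer where [A] exceeds [B] into the next layer. *)
Lemma cohits_dual_ge (A B : set K) : is_submodule iota A -> is_submodule iota B ->
  B `<=` A -> A `<=` val_ge (b 0%N) -> val_ge (b N) `<=` B ->
  (cohits N b d (dual iota B) + hits N b d B <=
   cohits N b d (dual iota A) + hits N b d A)%N.
Proof.
move=> sA + + A0; have fH := filtration_hits bS; have sA' := subspace_submodule sA.
have [m] := ubnP (hits N b d A - hits N b d B)%N.
elim: m B => // m IH B ltm sB BA NB.
have sB' := subspace_submodule sB.
have [AB|nAB] := pselect (A `<=` B).
  by rewrite (_ : A = B) //; apply/seteqP.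
have [|s [sN [x [Ax Fx nBx]] AsB]] :=
  @last_outside _ _ (fun s => val_ge (b s)) N A B A0 _ nAB.
  by move=> x [_ /NB].
have Bm a : nonunit a -> B (iota a * x).
  move=> na; apply: AsB; split; first by case: sA => _ _; apply.
  rewrite bS //; apply/val_geS; split; first exact: val_ge_iotaM.
  by rewrite addrC rmorphM; apply: (nval_geM (nv _)) => //; apply: val_nonunit.
have sBx := submodule_adjoin sB Bm.
have BxA := adjoin_sub sA' BA Ax.
have hitE : hits N b d (adjoin B x) = (hits N b d B).+1.
  rewrite !(hitsE bS) (jumps_adjoin fH) //; last exact: A0.
  exact: subset_trans BA A0.
have hle : (hits N b d (adjoin B x) <= hits N b d A)%N.
  by rewrite !(hitsE bS); apply: jumps_mono.
have [y yP] := dual_adjoin_line symO sB Bm.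
have cle : (cohits N b d (dual iota B) <= (cohits N b d (dual iota (adjoin B x))).+1)%N.
  rewrite !(cohitsE bS).
  apply: leq_trans (jumps_mono _ _ yP) _.
  apply: (jumps_adjoin_le (filtration_cohits bS)).
  exact: (subspace_submodule (submodule_dual _)).
have := IH (adjoin B x) _ sBx BxA (subset_trans NB (@sub_adjoin _ _ B x)).
by rewrite hitE in hle *; move=> /(_ _); lia.
Qed.

End Chain.

(** [cohits_dual_ge], applied from [K(b N)] up to [I], bounds the hits of [I] and
    of its dual together from below by the number of steps. *)
Lemma symmetric_dual I lo up : symmetric_pair (range iota) (range iota) ->
  is_submodule iota I -> I `<=` val_ge lo -> val_ge up `<=` I ->
  symmetric_pair I (dual iota I).
Proof.
move=> symO sI Ilo upI beta i gap.
have [N [b [d [s [bS [sN bs ds] b0 bN]]]]] := exists_walk beta i lo up.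
rewrite -bs -ds; apply: (hits_dual_eq sN); last by rewrite bs ds.
have bI := subset_trans (val_ge_mono bN) upI.
have := cohits_dual_ge bS symO sI (submodule_val_ge _) bI
  (subset_trans Ilo (val_ge_mono b0)) (fun x => id).
have := jumps_mono (fun s => val_ge (c - b (N - s)%N)) N (@val_ge_sub_dual (b N)).
rewrite -!(cohitsE bS); have := hits_val_ge N b d (b N); lia.
Qed.

Lemma fractional_bounds I : fractional_ideal iota I ->
  exists lo up, I `<=` val_ge lo /\ val_ge up `<=` I.
Proof.
move=> [[I0 ID IM] [a ra Ia] [e re eI]].
have [_ reg _] := curve_fractions curve.
have [alpha aP] := unit_val (reg a ra); have [eps eP] := unit_val (reg e re).
exists (- eps), (alpha + c); split=> [x Ix|h hP].
  by apply: (val_ge_cancel eP); rewrite subrr; apply: range_sub_normalization; apply: eI.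
have [z zc ->] := divisible aP hP; have [f _ <-] := val_ge_cond_sub zc.
by rewrite mulrC; apply: IM.
Qed.

Lemma fractional_range : fractional_ideal iota (range iota).
Proof.
have reg1 : GRing.lreg (1 : O) by move=> x y; rewrite !mul1r.
split; first exact: submodule_range; exists 1 => //.
by move=> x; rewrite rmorph1 mul1r.
Qed.

End Curve.

Theorem theorem26 (k : closedFieldType) (O K : comUnitAlgType k)
    (iota : {lrmorphism O -> K}) (r : nat) (P : 'I_r -> {pred O})
    (L : 'I_r -> fieldType) (pi : forall i, {rmorphism K -> L i})
    (v : forall i, L i -> \bar int) (c : {ffun 'I_r -> int}) :
  algebroid_curve iota P pi v ->
  is_conductor (value_set pi v (range iota)) c ->
  (forall I : set K, fractional_ideal iota I ->
     forall alpha : {ffun 'I_r -> int},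
       (p_ iota pi v I alpha + q_ iota pi v (dual iota I) (frob c - alpha)%R
          >= r.+1)%N) /\
  (gorenstein iota <->
     forall I : set K, fractional_ideal iota I ->
       forall alpha : {ffun 'I_r -> int},
         (p_ iota pi v I alpha + q_ iota pi v (dual iota I) (frob c - alpha)%R
            = r.+1)%N).
Proof.
move=> curve condc; split=> [I [sI _ _] alpha|]; first exact: (p_q_ge curve).
split=> [gor I fI alpha|eqO].
  have symO := symmetric_of_gorenstein curve condc gor.
  have [lo [up [Ilo upI]]] := fractional_bounds curve condc fI.
  have sI : is_submodule iota I by case: fI.
  exact: (p_q_eq curve condc alpha sI (symmetric_dual curve condc symO sI Ilo upI)).
apply: (gorenstein_of_symmetric curve condc).
apply: (symmetric_of_equality curve) => alpha; apply: eqO.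
exact: fractional_range.
Qed.
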